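(* Let $n\ge 1$ and let $X$ be a finite pure $n$-dimensional simplicial complex with connected links. Assume that $X$ is $K$-regular in the following sense: every vertex $\{v\}\in X(0)$ is contained in exactly $K$ $n$-dimensional simplices of $X$. Assume that there is a constant $0<\lambda<1$ such that for every $\tau\in X(n-2)$ the spectrum of the simple random walk on the graph $X_\tau$ is contained in $\left[-\frac{\lambda}{1+(n-1)\lambda},\frac{\lambda}{1+(n-1)\lambda}\right]\cup\{1\}$. Then for all pairwise disjoint sets $U_0,\dots,U_n\subseteq X(0)$, $$\left| |X(U_0,\dots,U_n)|-\frac{n!\,K}{|X(0)|^n}|U_0||U_1|\cdots|U_n|\right|\le C_n\, n!\,\lambda K\min_{0\le i<j\le n}\sqrt{|U_i||U_j|},$$ where $$C_n=\sum_{k=0}^{n-1}\left((k+1)(k+2)^{n-k}-(k+1)^{n-k+1}\right).$$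
   Context: $X(k)$ denotes the set of simplices of $X$ with $k+1$ vertices, $X(-1)=\{\emptyset\}$; a vertex $v$ is identified with $\{v\}\in X(0)$. $X$ is pure $n$-dimensional if every simplex is contained in a simplex of $X(n)$. For $\tau\in X(k)$ the link $X_\tau$ is the complex with $\eta\in X_\tau(l)$ iff $\eta\in X(l)$ and $\tau\cup\eta\in X(k+l+1)$; $X_\emptyset=X$. ''Connected links'' means that for every $-1\le k\le n-2$ and every $\tau\in X(k)$ the one-skeleton of $X_\tau$ (the graph with vertices $X_\tau(0)$ and edges $X_\tau(1)$) is connected; in particular the one-skeleton of $X$ is connected. For $\tau\in X(n-2)$, $X_\tau$ is a graph; the simple random walk operator on it sends $\phi:X_\tau(0)\to\mathbb{R}$ to the function $v\mapsto\frac{1}{\deg(v)}\sum_{u:\{u,v\}\in X_\tau(1)}\phi(u)$. For pairwise disjoint $U_0,\dots,U_n\subseteq X(0)$, $X(U_0,\dots,U_n)=\{\sigma\in X(n):|\sigma\cap U_i|=1\text{ for all }0\le i\le n\}$. *)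

(* Defs.v *)
From HB Require Import structures.
From mathcomp Require Import all_boot all_order all_algebra.
From mathcomp Require Import reals.

Set Implicit Arguments.
Unset Strict Implicit.
Unset Printing Implicit Defensive.

Import Order.TTheory GRing.Theory Num.Theory.
Local Open Scope ring_scope.

Section Complexes.
Variable T : finType.
Implicit Types (X : {set {set T}}) (s : {set T}).

(* The elements of T that are not vertices of X play no role. *)
Definition simplicial_complex X : Prop :=
  set0 \in X /\ forall s s' : {set T}, s \in X -> s' \subset s -> s' \in X.

(* Dimensions are integers, so that the empty simplex has dimension -1. *)
Definition sdim s : int := #|s|%:Z - 1.

Definition faces X (k : int) : {set {set T}} := [set s in X | sdim s == k].

Definition vertices X : {set T} := [set v | [set v] \in faces X 0].

Definition pure X (n : nat) : Prop :=
  forall s, s \in X -> exists2 s', s' \in faces X n & s \subset s'.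

(* The dimension condition on the union forces disjointness from t. *)
Definition link X (t : {set T}) : {set {set T}} :=
  [set s in X | t :|: s \in faces X (sdim t + sdim s + 1)].

(* Irreflexive, since [set u; u] has dimension 0. *)
Definition adj X : rel T := fun u v => [set u; v] \in faces X 1.

Definition connected_skeleton X : Prop :=
  forall u v, u \in vertices X -> v \in vertices X -> connect (adj X) u v.

Definition connected_links X (n : nat) : Prop :=
  forall k : int, -1 <= k <= n%:Z - 2 ->
  forall t, t \in faces X k -> connected_skeleton (link X t).

Definition regular X (n K : nat) : Prop :=
  forall v, v \in vertices X -> #|[set s in faces X n | v \in s]| = K.

Definition degree X (v : T) : nat := #|[set u | adj X u v]|.

Definition vertex X := {v : T | v \in vertices X}.

Definition transversal_faces X (n : nat) (U : 'I_n.+1 -> {set T}) :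
    {set {set T}} :=
  [set s in faces X n | [forall i, #|s :&: U i| == 1%N]].

End Complexes.

Section RandomWalk.
Variables (R : realType) (T : finType) (X : {set {set T}}).

Definition walk (phi : {ffun vertex X -> R^o}) : {ffun vertex X -> R^o} :=
  [ffun v => (degree X (val v))%:R^-1 *:
             \sum_(u : vertex X | adj X (val u) (val v)) phi u].

Fact walk_is_linear : linear walk.
Proof.
move=> a phi psi; apply/ffunP => v; rewrite !ffunE.
rewrite scalerA mulrC -scalerA -scalerDr; congr (_ *: _).
rewrite scaler_sumr -big_split /=.
by apply: eq_bigr => u _; rewrite !ffunE.
Qed.

HB.instance Definition _ :=
  GRing.isLinear.Build R {ffun vertex X -> R^o} {ffun vertex X -> R^o}
    *:%R walk walk_is_linear.

Definition walk_op : 'End({ffun vertex X -> R^o}) := linfun walk.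

End RandomWalk.

Section Constants.
Variable R : realType.

Definition mixing_const (n : nat) : R :=
  \sum_(k < n) (k.+1%:R * k.+2%:R ^+ (n - k) - k.+1%:R ^+ (n - k).+1).

Definition sqrt_cards (T : finType) (A B : {set T}) : R :=
  Num.sqrt (#|A|%:R * #|B|%:R).

(* For 1 <= n the default value, at the pair (0, n), is itself one of the
   terms, so that this is the minimum over all i < j. *)
Definition min_sqrt_cards (T : finType) (n : nat) (U : 'I_n.+1 -> {set T}) :
    R :=
  \big[Num.min/sqrt_cards (U ord0) (U ord_max)]_(p : 'I_n.+1 * 'I_n.+1
      | (p.1 < p.2)%N) sqrt_cards (U p.1) (U p.2).

End Constants.

Arguments walk R {T} X phi.
Arguments walk_op R {T} X.
Arguments sqrt_cards R {T} A B.
Arguments mixing_const R n.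
Arguments min_sqrt_cards R {T n} U.

(* Main.v *)
(* A family F of (n+1)-sets carries the weights m(v) = #{s in F : v in s} on
   vertices and #{s in F : u, v in s} on pairs, which define a reversible random
   walk.  Averaging the quadratic form of this walk over the links of vertices
   shows that, if all these links have spectrum below b apart from the trivial
   eigenvalue 1, an eigenvalue k of F satisfies k <= b + (1 - b) k^2; as k < 1 by
   connectedness, k <= b / (1 - b).  Lower bounds -b pass to F unchanged.
   Iterating from the links of codimension 2, the walk of every link contracts
   functions of mean zero by the factor lambda.

   Mixing follows by conditioning on one vertex v of a random ordered facet.  In
   the link of v the induction hypothesis replaces the probability that the other
   vertices fall in the U_i by the product of the conditional probabilities
   p_i(v).  These have variance at most lambda^2 p_i, so they may be replaced by
   their means p_i.  Keeping a fixed pair of sets for the two last vertices, the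
   total error is O(n^2) lambda (p_i p_j)^(1/2), with a constant below C_n. *)
Require Import Defs.
From HB Require Import structures.
From mathcomp Require Import all_boot all_order all_algebra.
From mathcomp Require Import reals.
From mathcomp Require boolp classical_sets topology normedtype derive.
From mathcomp Require Import zify ring lra.

Set Implicit Arguments.
Unset Strict Implicit.
Unset Printing Implicit Defensive.

Import Order.TTheory GRing.Theory Num.Theory.
Local Open Scope ring_scope.

(** * Rayleigh quotients *)

Section Maximum.
Import boolp classical_sets topology normedtype derive.
Import numFieldNormedType.Exports.
Variables (R : realType) (T : finType) (m : T -> R) (B : T -> T -> R).
Local Open Scope classical_set_scope.

Let rowV (x : 'rV[R]_#|T|) (v : T) : R := x ord0 (enum_rank v).

Let continuous_rowV v : continuous (rowV ^~ v).
Proof. exact: coord_continuous. Qed.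

Let continuous_sum (F : T -> 'rV[R]_#|T| -> R) :
  (forall v, continuous (F v)) -> continuous (fun x => \sum_v F v x).
Proof.
by move=> Fc; apply: continuous_big => //; exact: add_continuous.
Qed.

Let continuous_mul (F G : 'rV[R]_#|T| -> R) :
  continuous F -> continuous G -> continuous (fun x => F x * G x).
Proof. by move=> Fc Gc x; exact: (continuousM (Fc x) (Gc x)). Qed.

Let continuous_cst (a : R) : continuous (fun _ : 'rV[R]_#|T| => a).
Proof. exact: cst_continuous. Qed.

Let continuous_form :
  continuous (fun x => \sum_u \sum_v B u v * rowV x u * rowV x v).
Proof.
apply: continuous_sum => u; apply: continuous_sum => v.
by do 2?apply: continuous_mul.
Qed.

Let continuous_sqs (a : T -> R) :
  continuous (fun x => \sum_v a v * rowV x v ^+ 2).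
Proof.
apply: continuous_sum => v.
by do 2?apply: continuous_mul.
Qed.

(** Extreme value theorem: the constraints bound the coordinates of positive weight and force the
    others to vanish. Functions are coded as row vectors to work in a topological space where boxes
    are compact. *)
Lemma form_max (P : (T -> R) -> Prop) :
  (forall v, 0 <= m v) ->
  (forall f, P f <-> [/\ forall v, m v = 0 -> f v = 0,
     \sum_v m v * f v = 0 & \sum_v m v * f v ^+ 2 = 1]) ->
  (exists f, P f) ->
  exists2 f, P f & forall g, P g ->
    \sum_u \sum_v B u v * g u * g v <= \sum_u \sum_v B u v * f u * f v.
Proof.
move=> m_ge0 PE [f Pf].
(* The support conditions become a single vanishing sum of squares, a closed condition like the
   other two. *)
pose z v : R := (m v == 0)%:R.
pose C := [set x | \sum_v z v * rowV x v ^+ 2 = 0] `&`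
  ([set x | \sum_v m v * rowV x v = 0] `&`
   [set x | \sum_v m v * rowV x v ^+ 2 = 1]).
have CP x : C x <-> P (rowV x).
  rewrite PE; split.
    case=> /= /eqP; rewrite psumr_eq0 => [/allP/= x0 [x1 x2]|v _]; last first.
      by rewrite mulr_ge0 ?sqr_ge0.
    split=> // v /eqP mv0; move: (x0 v (mem_index_enum v)).
    by rewrite /z mv0 mul1r sqrf_eq0 => /eqP.
  case=> x0 x1 x2; split=> //=; apply: big1 => v _.
  by rewrite /z; case: eqP => [/x0 ->|_]; rewrite ?expr0n ?mulr0 ?mul0r.
have rowVK g : rowV (\row_i g (enum_val i)) = g.
  by apply/funext => v; rewrite /rowV mxE enum_rankK.
(* Half-width of a box containing [C]: if [x v ^+ 2 <= (m v)^-1] then [|x v| <= (m v)^-1 + 1], and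
   where the weight is 0 so is [x v]. *)
pose c := \sum_v ((m v)^-1 + 1).
have cptC : compact C.
  have closedC : closed C.
    have closed_at (F : 'rV[R]_#|T| -> R) b : continuous F ->
        closed [set x | F x = b].
      move=> Fc; apply: (@preimage_closed _ _ F [set y | y = b]).
        by move=> x _; exact: Fc.
      exact: closed_eq.
    apply: closedI; first by apply: closed_at; exact: continuous_sqs.
    apply: closedI; last by apply: closed_at; exact: continuous_sqs.
    apply: closed_at; apply: continuous_sum => v.
    exact: continuous_mul.
  have cpt_box : compact
      [set x : 'rV[R]_#|T| | forall i, x ord0 i \in `[- c, c]%R].
    by apply: (rV_compact (A := fun=> `[- c, c])) => _; exact: segment_compact.
  apply: subclosed_compact closedC cpt_box _ => x /CP /PE [x0 _ x2] i /=.
  rewrite in_itv/= -ler_norml -(enum_valK i); set v := enum_val i.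
  have c1 : (m v)^-1 + 1 <= c.
    rewrite /c (bigD1 v)//= lerDl sumr_ge0// => u _.
    by rewrite addr_ge0 ?invr_ge0.
  apply: le_trans c1; rewrite -/(rowV x v).
  have [/x0 ->|/eqP mv0] := eqVneq (m v) 0.
    by rewrite normr0 addr_ge0 ?invr_ge0.
  have mv_gt0 : 0 < m v by rewrite lt_def m_ge0 andbT; apply/eqP.
  have : rowV x v ^+ 2 <= (m v)^-1.
    rewrite -[leRHS]mulr1 mulrC ler_pdivlMr// mulrC -x2 (bigD1 v)//= lerDl.
    by rewrite sumr_ge0// => u _; rewrite mulr_ge0 ?sqr_ge0.
  rewrite -real_normK ?num_real//.
  have : 0 <= (m v)^-1 by rewrite invr_ge0.
  have := normr_ge0 (rowV x v).
  nra.
have C0 : C !=set0 by exists (\row_i f (enum_val i)); apply/CP; rewrite rowVK.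
have [|x xC xmax] := compact_EVT_max C0 cptC
  (f := fun x => \sum_u \sum_v B u v * rowV x u * rowV x v).
  exact/continuous_subspaceT/continuous_form.
exists (rowV x); first by apply/CP; rewrite inE in xC.
move=> g Pg; have := xmax (\row_i g (enum_val i)).
by rewrite !rowVK; apply; rewrite inE; apply/CP; rewrite rowVK.
Qed.

End Maximum.

(** * Maximisers of the Rayleigh quotient are eigenfunctions *)

Section Rayleigh.
Variables (R : realType) (T : finType) (m : T -> R) (B : T -> T -> R).
Hypothesis m_ge0 : forall v, 0 <= m v.
Hypothesis B_sym : forall u v, B u v = B v u.
Hypothesis B_supp : forall u v, m v = 0 -> B u v = 0.

Let Q f g := \sum_u \sum_v B u v * f u * g v.
Let N f := \sum_v m v * f v ^+ 2.

Let QD f g t : Q (fun v => f v + t * g v) (fun v => f v + t * g v) =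
  Q f f + 2 * t * Q f g + t ^+ 2 * Q g g.
Proof.
have QC : Q f g = \sum_u \sum_v B u v * g u * f v.
  rewrite /Q exchange_big; apply: eq_bigr => u _; apply: eq_bigr => v _.
  by rewrite B_sym mulrAC.
rewrite (_ : 2 * t * Q f g = t * Q f g + t * Q f g); last by ring.
rewrite {2}QC /Q !mulr_sumr -!big_split; apply: eq_bigr => u _ /=.
rewrite !mulr_sumr -!big_split; apply: eq_bigr => v _ /=; ring.
Qed.

Let ND f g t : N (fun v => f v + t * g v) =
  N f + 2 * t * (\sum_v m v * f v * g v) + t ^+ 2 * N g.
Proof.
rewrite /N !mulr_sumr -!big_split; apply: eq_bigr => v _ /=; ring.
Qed.

Let QZ t f : Q (fun v => t * f v) (fun v => t * f v) = t ^+ 2 * Q f f.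
Proof.
rewrite /Q mulr_sumr; apply: eq_bigr => u _; rewrite mulr_sumr.
by apply: eq_bigr => v _; ring.
Qed.

Let NZ t f : N (fun v => t * f v) = t ^+ 2 * N f.
Proof. by rewrite /N mulr_sumr; apply: eq_bigr => v _; ring. Qed.

(** The form attains its maximum [kappa] on the unit sphere of mean-zero functions, and a
    first-order variation shows that the maximiser is an eigenfunction. Row sums proportional to [m]
    keep this variation among functions of mean zero. *)
Lemma rayleigh_bound (c beta : R) :
  (forall v, \sum_u B u v = c * m v) ->
  (forall (f : T -> R) (kappa : R),
    (forall v, m v = 0 -> f v = 0) -> (exists v, f v != 0) ->
    \sum_v m v * f v = 0 ->
    (forall v, \sum_u B u v * f u = kappa * m v * f v) -> kappa <= beta) ->
  forall f : T -> R, \sum_v m v * f v = 0 ->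
    \sum_u \sum_v B u v * f u * f v <= beta * (\sum_v m v * f v ^+ 2).
Proof.
move=> B1 eigen f f0; rewrite -/(Q f f) -/(N f).
pose V g := (forall v, m v = 0 -> g v = 0) /\ \sum_v m v * g v = 0.
pose P g := [/\ forall v, m v = 0 -> g v = 0,
     \sum_v m v * g v = 0 & N g = 1].
have N_ge0 g : 0 <= N g by rewrite sumr_ge0// => v _; rewrite mulr_ge0 ?sqr_ge0.
have N_eq0 g : N g = 0 -> forall v, m v = 0 \/ g v = 0.
  move/eqP; rewrite psumr_eq0 => [/allP/= g0 v|v _]; last first.
    by rewrite mulr_ge0 ?sqr_ge0.
  move: (g0 v (mem_index_enum v)).
  by rewrite mulf_eq0 sqrf_eq0 => /orP[]/eqP; [left|right].
have B_supp' u v : m u = 0 -> B u v = 0 by rewrite B_sym; exact: B_supp.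
(* Values at points of weight zero enter neither the form nor the norm, so they may be set to 0. *)
wlog fV : f f0 / V f.
  move=> /(_ (fun v => if m v == 0 then 0 else f v)).
  have E1 : \sum_v m v * (if m v == 0 then 0 else f v) = 0.
    by rewrite -[RHS]f0; apply: eq_bigr => v _; case: eqP => // ->; rewrite !mul0r.
  have -> : N (fun v => if m v == 0 then 0 else f v) = N f.
    by apply: eq_bigr => v _; case: eqP => // ->; rewrite !mul0r.
  have -> : Q (fun v => if m v == 0 then 0 else f v)
              (fun v => if m v == 0 then 0 else f v) = Q f f.
    apply: eq_bigr => u _; apply: eq_bigr => v _.
    have [/B_supp' ->|_] := eqVneq (m u) 0; first by rewrite !mul0r.
    by have [/B_supp ->|_] := eqVneq (m v) 0; rewrite ?mul0r.
  by apply=> //; split=> // v ->; rewrite eqxx.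
have [Nf0|Nf_neq0] := eqVneq (N f) 0.
  rewrite Nf0 mulr0 le_eqVlt; apply/orP; left; apply/eqP.
  apply: big1 => u _; apply: big1 => v _.
  by case: (N_eq0 f Nf0 v) => [/B_supp ->|->]; rewrite ?mul0r ?mulr0.
have VP g : V g -> N g != 0 -> P (fun v => (Num.sqrt (N g))^-1 * g v).
  move=> [g0 g1] Ng; split=> [v /g0 ->||]; first by rewrite mulr0.
    under eq_bigr do rewrite mulrCA.
    by rewrite -mulr_sumr g1 mulr0.
  by rewrite NZ exprVn sqr_sqrtr// mulVf.
have [f1 [f1s f11 f1N] f1max] := @form_max R T m B P m_ge0
  (fun g => iff_refl _) (ex_intro _ _ (VP f fV Nf_neq0)).
have [kappa kappaE] : exists k, k = Q f1 f1 by exists (Q f1 f1).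
have kappaP g : V g -> Q g g <= kappa * N g.
  move=> Vg; have [Ng0|Ng] := eqVneq (N g) 0.
    rewrite Ng0 mulr0 le_eqVlt; apply/orP; left; apply/eqP.
    apply: big1 => u _; apply: big1 => v _.
    by case: (N_eq0 g Ng0 v) => [/B_supp ->|->]; rewrite ?mul0r ?mulr0.
  have := f1max _ (VP g Vg Ng).
  rewrite -/(Q _ _) QZ exprVn sqr_sqrtr// -/(Q f1 f1) -kappaE mulrC.
  by rewrite ler_pdivrMr// lt_def Ng N_ge0.
have kappa_le : kappa <= beta.
  (* [r] is the defect in the eigenvalue equation. The variation follows [g = r / m], whose pairing
     with [r] is [rho], the sum of the [r v ^+ 2 / m v]; once [rho] vanishes, so does [r]. *)
  pose r v := kappa * m v * f1 v - \sum_u B u v * f1 u.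
  have r_supp v : m v = 0 -> r v = 0.
    move=> mv0; rewrite /r mv0 mulr0 mul0r sub0r big1 ?oppr0// => u _.
    by rewrite B_supp ?mul0r.
  pose g v := (m v)^-1 * r v.
  have mg v : m v * g v = r v.
    have [mv0|mv0] := eqVneq (m v) 0; first by rewrite mv0 r_supp// mul0r.
    by rewrite /g mulrA mulfV// mul1r.
  have Vg : V g.
    split=> [v mv0|]; first by rewrite /g r_supp// mulr0.
    under eq_bigr do rewrite mg.
    rewrite /r sumrB.
    under eq_bigr do rewrite -mulrA.
    rewrite -mulr_sumr f11 mulr0 sub0r exchange_big /=.
    apply/eqP; rewrite oppr_eq0; apply/eqP.
    under eq_bigr do rewrite -mulr_suml.
    under eq_bigr do under eq_bigr do rewrite B_sym.
    under eq_bigr do rewrite B1 -mulrA.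
    by rewrite -mulr_sumr f11 mulr0.
  pose rho := \sum_v r v * g v.
  have rhoE : rho = kappa * (\sum_v m v * f1 v * g v) - Q f1 g.
    rewrite /rho /Q exchange_big mulr_sumr -sumrB; apply: eq_bigr => v _ /=.
    by rewrite {1}/r mulrBl mulr_suml !(mulrA kappa).
  have H t : 0 <= 2 * t * rho + t ^+ 2 * (kappa * N g - Q g g).
    have Vt : V (fun v => f1 v + t * g v).
      split=> [v mv0|]; first by rewrite f1s// (proj1 Vg)// mulr0 addr0.
      under eq_bigr do rewrite mulrDr mulrCA.
      by rewrite big_split /= -mulr_sumr (proj2 Vg) f11 mulr0 addr0.
    have := kappaP _ Vt; rewrite QD ND f1N -kappaE rhoE => H; nra.
  have rho0 : rho = 0.
    set h := kappa * N g - Q g g in H.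
    have h_ge0 : 0 <= h by rewrite subr_ge0; exact: kappaP.
    have h1 : 0 < h + 1 by rewrite ltr_wpDl.
    (* Close to the minimiser [- rho / h]; adding 1 avoids a division by zero and still makes the
       quadratic negative unless [rho = 0]. *)
    have := H (- rho / (h + 1)).
    have -> : 2 * (- rho / (h + 1)) * rho + (- rho / (h + 1)) ^+ 2 * h =
        - (rho ^+ 2 * ((h + 2) / (h + 1) ^+ 2)) by field; rewrite gt_eqF.
    rewrite oppr_ge0 pmulr_lle0 ?divr_gt0 ?exprn_gt0 ?ltr_wpDl// => rho_le0.
    by apply/eqP; rewrite -sqrf_eq0 eq_le rho_le0 sqr_ge0.
  have r0 v : r v = 0.
    move/eqP: rho0; rewrite psumr_eq0 => [/allP/(_ v (mem_index_enum v))|u _].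
      rewrite /= -mg -mulrA mulf_eq0 -expr2 sqrf_eq0.
      by case/orP => /eqP ->; rewrite ?mul0r ?mulr0.
    by rewrite -mg -mulrA -expr2 mulr_ge0 ?sqr_ge0.
  apply: (eigen f1 kappa) => // [|v].
    apply/existsP; apply: contraPT f1N => /existsPn f10.
    rewrite /N big1 => [/esym/eqP|v _]; first by rewrite oner_eq0.
    by rewrite (eqP (negbNE (f10 v))) expr0n mulr0.
  by apply/eqP; rewrite eq_sym -subr_eq0; apply/eqP; exact: r0.
by apply: le_trans (kappaP f fV) _; rewrite ler_wpM2r.
Qed.

End Rayleigh.

(** * Links in uniform families *)

Section LinkFamilies.
Variable T : finType.
Implicit Types (F : {set {set T}}) (s : {set T}) (u v : T).

Definition uniform F (d : nat) := forall s, s \in F -> #|s| = d.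

(* F is the set of facets of a pure complex, lk F v that of the link of v. *)
Definition lk F v : {set {set T}} := [set s : {set T} | (v \notin s) && (v |: s \in F)].

Lemma lkC F u v : lk (lk F u) v = lk (lk F v) u.
Proof.
apply/setP => s; rewrite !inE !negb_or setUCA (eq_sym u v).
by case: (v != u); case: (v \notin s); case: (u \notin s).
Qed.

Lemma uniform_lk F d v : uniform F d.+1 -> uniform (lk F v) d.
Proof.
by move=> Fd s; rewrite inE => /andP[vs /Fd]; rewrite cardsU1 vs => -[].
Qed.
#[global] Arguments uniform_lk {F d} v.

Lemma card_lk F v : #|lk F v| = #|[set s : {set T} in F | v \in s]|.
Proof.
rewrite -(card_in_imset (f := fun s : {set T} => v |: s) (D := lk F v)); last first.
  move=> s1 s2; rewrite !inE => /andP[v1 _] /andP[v2 _] E.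
  by rewrite -(setU1K v1) E setU1K.
congr #|pred_of_set _|; apply/setP => s; rewrite inE.
apply/imsetP/andP => [[s1]|[sF vs]].
  by rewrite inE => /andP[vs1 s1F] ->; rewrite setU11.
by exists (s :\ v); rewrite ?inE ?eqxx ?setD1K.
Qed.

Lemma lk_eq0P F v : reflect (forall s, s \in F -> v \notin s) (#|lk F v| == 0%N).
Proof.
rewrite card_lk cards_eq0; apply: (iffP eqP) => [E s sF|H].
  by apply/negP => vs; have := in_set0 s; rewrite -E inE sF vs.
by apply/setP => s; rewrite !inE; apply/andP => -[/H/negbTE ->].
Qed.

Lemma sum_card_lk F d : uniform F d -> (\sum_v #|lk F v| = d * #|F|)%N.
Proof.
move=> Fd.
transitivity (\sum_v \sum_(s in F) (v \in s))%N.
  apply: eq_bigr => v _; rewrite card_lk -sum1_card big_mkcond /=.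
  rewrite [RHS]big_mkcond; apply: eq_bigr => s _; rewrite inE.
  by case: (s \in F); case: (v \in s).
rewrite exchange_big /= mulnC -sum_nat_const; apply: eq_bigr => s /Fd <-.
by rewrite -sum1_card [RHS]big_mkcond; apply: eq_bigr => v _; case: (v \in s).
Qed.

Lemma lk2_gt0 F u v s :
  s \in F -> u \in s -> v \in s -> u != v -> (0 < #|lk (lk F u) v|)%N.
Proof.
move=> sF us vs uv; rewrite lt0n; apply/negP => /lk_eq0P /(_ (s :\ u)).
by rewrite !inE eqxx setD1K// vs (eq_sym v u) uv => /(_ sF).
Qed.

Variable R : realType.
Implicit Types (f g : T -> R).

Definition vsum F f : R := \sum_v #|lk F v|%:R * f v.

(** The sum runs over ordered pairs of vertices; the diagonal contributes nothing because
    [lk (lk F u) u] is empty. *)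
Definition qform F f g : R := \sum_u f u * vsum (lk F u) g.

Lemma qformE F f g :
  qform F f g = \sum_u \sum_v #|lk (lk F u) v|%:R * f u * g v.
Proof.
apply: eq_bigr => u _; rewrite mulr_sumr; apply: eq_bigr => v _.
by rewrite mulrCA mulrA.
Qed.

Lemma qformC F f g : qform F f g = qform F g f.
Proof.
rewrite !qformE exchange_big; apply: eq_bigr => u _; apply: eq_bigr => v _.
by rewrite lkC mulrAC.
Qed.

Lemma eq_vsum F f g : f =1 g -> vsum F f = vsum F g.
Proof. by move=> fg; apply: eq_bigr => v _; rewrite fg. Qed.

Lemma vsumD F f g : vsum F (fun v => f v + g v) = vsum F f + vsum F g.
Proof. by rewrite -big_split; apply: eq_bigr => v _; rewrite mulrDr. Qed.

Lemma vsumZ F c f : vsum F (fun v => c * f v) = c * vsum F f.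
Proof. by rewrite mulr_sumr; apply: eq_bigr => v _; rewrite mulrCA. Qed.

Lemma vsum_ge0 F f : (forall v, 0 <= f v) -> 0 <= vsum F f.
Proof. by move=> f0; rewrite sumr_ge0// => v _; rewrite mulr_ge0. Qed.

Lemma vsum1 F d : uniform F d -> vsum F (fun=> 1) = (d * #|F|)%:R.
Proof.
move=> Fd; rewrite -(sum_card_lk Fd) natr_sum; apply: eq_bigr => v _.
by rewrite mulr1.
Qed.

(** Double counting: a member of [F] containing [v] survives in the links of its [d] other
    vertices. *)
Lemma vsum_link F d f :
  uniform F d.+1 -> \sum_w vsum (lk F w) f = d%:R * vsum F f.
Proof.
move=> Fd; rewrite exchange_big mulr_sumr; apply: eq_bigr => v _ /=.
under eq_bigr do rewrite lkC.
by rewrite -mulr_suml -natr_sum (sum_card_lk (uniform_lk v Fd)) natrM mulrA.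
Qed.

(** Garland's localisation: a member containing [u] and [v] is seen from each of its [d] other
    vertices. *)
Lemma qform_link F d f g :
  uniform F d.+2 -> \sum_w qform (lk F w) f g = d%:R * qform F f g.
Proof.
move=> Fd; rewrite exchange_big mulr_sumr; apply: eq_bigr => u _ /=.
under eq_bigr do rewrite lkC.
by rewrite -mulr_sumr (vsum_link _ (uniform_lk u Fd)) mulrCA.
Qed.

Lemma qform1 F d g : uniform F d.+1 -> qform F (fun=> 1) g = d%:R * vsum F g.
Proof.
by move=> Fd; rewrite -(vsum_link _ Fd); apply: eq_bigr => v _; rewrite mul1r.
Qed.

Lemma qformDl F f g h :
  qform F (fun v => f v + g v) h = qform F f h + qform F g h.
Proof. by rewrite -big_split; apply: eq_bigr => v _; rewrite mulrDl. Qed.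

Lemma qformZl F c f h : qform F (fun v => c * f v) h = c * qform F f h.
Proof. by rewrite mulr_sumr; apply: eq_bigr => v _; rewrite mulrA. Qed.

Lemma qformDr F f g h :
  qform F h (fun v => f v + g v) = qform F h f + qform F h g.
Proof. by rewrite !(qformC F h) qformDl. Qed.

Lemma qformZr F c f h : qform F h (fun v => c * f v) = c * qform F h f.
Proof. by rewrite !(qformC F h) qformZl. Qed.

Lemma eq_qform F f f' g g' : f =1 f' -> g =1 g' -> qform F f g = qform F f' g'.
Proof.
by move=> ff' gg'; apply: eq_bigr => u _; rewrite ff' (eq_vsum _ gg').
Qed.

Lemma lk_empty F v : #|F| = 0%N -> #|lk F v| = 0%N.
Proof.
move/eqP; rewrite cards_eq0 => /eqP ->; apply/eqP/lk_eq0P => s.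
by rewrite inE.
Qed.

Lemma vsum_empty F f : #|F| = 0%N -> vsum F f = 0.
Proof. by move=> F0; apply: big1 => v _; rewrite lk_empty// mul0r. Qed.

(** Splits off the constant part [c]. By [qform1] constants are eigenfunctions with eigenvalue [d],
    so there are no cross terms. If [F] is empty, all these sums vanish. *)
Lemma mean_decomposition F d f : uniform F d.+1 ->
  exists c g, [/\ vsum F g = 0, vsum F f = c * (d.+1 * #|F|)%:R,
    qform F f f = qform F g g + d%:R * (c ^+ 2 * (d.+1 * #|F|)%:R) &
    vsum F (fun v => f v ^+ 2) =
      vsum F (fun v => g v ^+ 2) + c ^+ 2 * (d.+1 * #|F|)%:R].
Proof.
move=> Fd; pose W : R := (d.+1 * #|F|)%:R; pose c := vsum F f / W.
have fW : vsum F f = c * W.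
  have [F0|F0] := eqVneq #|F| 0%N; first by rewrite /W F0 muln0 mulr0 vsum_empty.
  by rewrite mulfVK// pnatr_eq0 muln_eq0.
have [g fE g0] : exists2 g, f =1 (fun v => g v + c * 1) & vsum F g = 0.
  exists (fun v => f v + (- c) * 1); first by move=> v; ring.
  by rewrite vsumD vsumZ (vsum1 Fd) fW; ring.
exists c, g; split => //.
  rewrite (eq_qform _ fE fE) !(qformDl, qformDr, qformZl, qformZr).
  rewrite (qformC _ g (fun=> 1)) !(qform1 _ Fd) g0 (vsum1 Fd) -/W; ring.
rewrite (@eq_vsum _ (fun v => f v ^+ 2)
  (fun v => g v ^+ 2 + ((2 * c) * g v + c ^+ 2 * 1))); last first.
  by move=> v; rewrite fE; ring.
rewrite !(vsumD, vsumZ) g0 (vsum1 Fd) -/W; ring.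
Qed.

End LinkFamilies.

Arguments lk {T}.

(** * Trickling down *)

Section Trickling.
Variables (R : realType) (T : finType).
Implicit Types (F : {set {set T}}) (f g : T -> R) (b : R).

(* Connectedness of the 1-skeleton, without paths. *)
Definition rigid F := forall f,
  (forall s u v, s \in F -> u \in s -> v \in s -> f u = f v) ->
  forall s s' u v, s \in F -> s' \in F -> u \in s -> v \in s' -> f u = f v.

(** For members of size d + 1 the pair weights at [u] add up to [d] times the weight of [u]; the
    factor [d] thus normalises the trivial eigenvalue to 1. *)
Definition spectral_le F (d : nat) b := forall f, vsum F f = 0 ->
  qform F f f <= d%:R * b * vsum F (fun v => f v ^+ 2).

Definition spectral_ge F (d : nat) b := forall f, vsum F f = 0 ->
  d%:R * b * vsum F (fun v => f v ^+ 2) <= qform F f f.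

Lemma spectral_leW F d b b' : b <= b' -> spectral_le F d b -> spectral_le F d b'.
Proof.
move=> bb' H f /H /le_trans; apply; apply: ler_wpM2r.
  by apply: vsum_ge0 => v; exact: sqr_ge0.
by rewrite ler_wpM2l.
Qed.

Lemma spectral_geW F d b b' : b' <= b -> spectral_ge F d b -> spectral_ge F d b'.
Proof.
move=> bb' H f /H; apply: le_trans; apply: ler_wpM2r.
  by apply: vsum_ge0 => v; exact: sqr_ge0.
by rewrite ler_wpM2l.
Qed.

(** A function of mean zero on [F] need not have mean zero on the links. Its constant part there has
    eigenvalue 1 instead of at most [b], whence the correction [1 - b]. *)
Lemma spectral_le_mean F d b f : uniform F d.+1 -> spectral_le F d b ->
  exists2 c, vsum F f = c * (d.+1 * #|F|)%:R &
  qform F f f <= d%:R * (b * vsum F (fun v => f v ^+ 2) +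
    (1 - b) * (c ^+ 2 * (d.+1 * #|F|)%:R)).
Proof.
move=> Fd H; have [c [g [/H gH fE qE vE]]] := mean_decomposition f Fd.
exists c => //; rewrite qE vE; set W := c ^+ 2 * _.
apply: le_trans (lerD gH (lexx _)) _; rewrite le_eqVlt; apply/orP; left.
by apply/eqP; ring.
Qed.

Lemma spectral_ge_mean F d b f : uniform F d.+1 -> b <= 1 ->
  spectral_ge F d b ->
  d%:R * b * vsum F (fun v => f v ^+ 2) <= qform F f f.
Proof.
move=> Fd b1 H; have [c [g [/H gH fE qE vE]]] := mean_decomposition f Fd.
rewrite qE vE mulrDr lerD// -mulrA ler_wpM2l//.
by rewrite ler_piMl// mulr_ge0 ?sqr_ge0.
Qed.

(** On each link the constant part has eigenvalue [1 >= b] and only helps, so summing over the links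
    loses nothing. *)
Lemma trickle_ge F d b : uniform F d.+3 -> b <= 1 ->
  (forall w, spectral_ge (lk F w) d.+1 b) -> spectral_ge F d.+2 b.
Proof.
move=> Fd b1 H f f0.
rewrite -(ler_pM2l (ltr0Sn R d)) -(qform_link _ _ Fd).
rewrite [d.+2%:R * b]mulrC -[b * _ * _]mulrA -(vsum_link _ Fd) mulrA mulr_sumr.
apply: ler_sum => w _.
exact: spectral_ge_mean f (uniform_lk w Fd) b1 (H w).
Qed.

(** If [kappa >= d + 1], the Dirichlet form of [f] is at most 0, so [f] agrees on vertices of a
    common member. Rigidity then makes it constant on the support, and mean zero makes it vanish. *)
Lemma eigenvalue_lt F d f kappa : uniform F d.+2 -> rigid F ->
  (forall v, #|lk F v|%:R = 0 :> R -> f v = 0) -> (exists v, f v != 0) ->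
  vsum F f = 0 ->
  (forall v, vsum (lk F v) f = kappa * #|lk F v|%:R * f v) -> kappa < d.+1%:R.
Proof.
move=> Fd Frig f_supp [v0 fv0] f0 fE; rewrite ltNge; apply/negP => kd.
have qE : qform F f f = kappa * vsum F (fun v => f v ^+ 2).
  rewrite mulr_sumr; apply: eq_bigr => v _; rewrite fE; ring.
have dirichlet : \sum_u \sum_v #|lk (lk F u) v|%:R * (f u - f v) ^+ 2 =
    2 * (d.+1%:R * vsum F (fun v => f v ^+ 2) - qform F f f).
  have E1 : qform F (fun v => f v ^+ 2) (fun=> 1) =
            d.+1%:R * vsum F (fun v => f v ^+ 2) by rewrite qformC (qform1 _ Fd).
  rewrite mulr_natl mulr2n -{1}E1 -E1 {2}(qformC F (fun v => f v ^+ 2)) !qformE.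
  rewrite -!sumrB -!big_split; apply: eq_bigr => u _ /=.
  by rewrite -!sumrB -!big_split; apply: eq_bigr => v _ /=; ring.
have term_ge0 u v : 0 <= #|lk (lk F u) v|%:R * (f u - f v) ^+ 2.
  by rewrite mulr_ge0 ?sqr_ge0.
have const s u v : s \in F -> u \in s -> v \in s -> f u = f v.
  move=> sF us vs; have [->//|uv] := eqVneq u v.
  have : \sum_u \sum_v #|lk (lk F u) v|%:R * (f u - f v) ^+ 2 == 0.
    rewrite eq_le sumr_ge0 => [|? _]; last by rewrite sumr_ge0.
    rewrite andbT dirichlet qE -mulrBl mulr_ge0_le0 ?mulr_le0_ge0 ?subr_le0//.
    by apply: vsum_ge0 => ?; exact: sqr_ge0.
  rewrite psumr_eq0 => [/allP/(_ u (mem_index_enum u))/=|? _]; last first.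
    by rewrite sumr_ge0.
  rewrite psumr_eq0// => /allP/(_ v (mem_index_enum v))/=.
  rewrite mulf_eq0 sqrf_eq0 subr_eq0 pnatr_eq0 => /orP[|/eqP//].
  by rewrite eqn0Ngt (lk2_gt0 sF).
have m0 : #|lk F v0| != 0%N.
  by apply: contraNneq fv0 => m0; rewrite f_supp// m0.
have [s sF v0s] : exists2 s, s \in F & v0 \in s.
  move: m0; rewrite card_lk -lt0n card_gt0 => /set0Pn[s].
  by rewrite inE => /andP[sF vs]; exists s.
have : vsum F f = f v0 * vsum F (fun=> 1).
  rewrite -vsumZ; apply: eq_bigr => v _; rewrite mulr1.
  have [->|] := eqVneq #|lk F v| 0%N; first by rewrite !mul0r.
  rewrite card_lk -lt0n card_gt0 => /set0Pn[s']; rewrite inE => /andP[s'F vs'].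
  by rewrite (Frig f const s s' v0 v).
move/eqP; rewrite f0 eq_sym mulf_eq0 (negPf fv0) (vsum1 _ Fd) pnatr_eq0/=.
rewrite muln_eq0/= cards_eq0 => /eqP F0.
by rewrite F0 inE in sF.
Qed.

Lemma spectral_le_eigen F d b : uniform F d.+2 ->
  (forall f kappa, (forall v, #|lk F v|%:R = 0 :> R -> f v = 0) ->
    (exists v, f v != 0) -> vsum F f = 0 ->
    (forall v, vsum (lk F v) f = d.+1%:R * kappa * #|lk F v|%:R * f v) ->
    kappa <= b) ->
  spectral_le F d.+1 b.
Proof.
move=> Fd H f f0; rewrite qformE; pose B u v : R := #|lk (lk F u) v|%:R.
have B_sym u v : B u v = B v u by rewrite /B lkC.
apply: (@rayleigh_bound R T (fun v => #|lk F v|%:R) B _ B_sym _ d.+1%:R) => //.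
- move=> u v /eqP; rewrite B_sym pnatr_eq0 cards_eq0 => /eqP Fv0.
  by rewrite /B Fv0 lk_empty// cards0.
- move=> v; under eq_bigr do rewrite B_sym.
  by rewrite -natr_sum (sum_card_lk (uniform_lk v Fd)) natrM.
move=> g kappa g_supp g_n0 g0 gE.
have := H g (kappa / d.+1%:R) g_supp g_n0 g0.
rewrite ler_pdivrMr// [b * _]mulrC => -> // v.
rewrite [_ * (_ / _)]mulrC divfK ?pnatr_eq0// -gE; apply: eq_bigr => u _.
by rewrite -/(B v u) B_sym.
Qed.

Lemma spectral_ge_eigen F d b : uniform F d.+2 ->
  (forall f kappa, (forall v, #|lk F v|%:R = 0 :> R -> f v = 0) ->
    (exists v, f v != 0) -> vsum F f = 0 ->
    (forall v, vsum (lk F v) f = d.+1%:R * kappa * #|lk F v|%:R * f v) ->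
    b <= kappa) ->
  spectral_ge F d.+1 b.
Proof.
(* The lower bound is the upper bound for the negated form, whose row sums are [- d.+1] times the
   weights. *)
move=> Fd H f f0; pose B u v : R := - #|lk (lk F u) v|%:R.
have B_sym u v : B u v = B v u by rewrite /B lkC.
have -> : qform F f f = - (\sum_u \sum_v B u v * f u * f v).
  rewrite qformE -sumrN; apply: eq_bigr => u _; rewrite -sumrN.
  by apply: eq_bigr => v _; rewrite /B !mulNr opprK.
rewrite lerNr -mulNr.
apply: (@rayleigh_bound R T (fun v => #|lk F v|%:R) B _ B_sym _ (- d.+1%:R)) => //.
- move=> u v /eqP; rewrite B_sym pnatr_eq0 cards_eq0 => /eqP Fv0.
  by rewrite /B Fv0 lk_empty ?cards0 ?oppr0.
- move=> v; under eq_bigr do rewrite B_sym.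
  by rewrite sumrN mulNr -natr_sum (sum_card_lk (uniform_lk v Fd)) natrM.
move=> g kappa g_supp g_n0 g0 gE.
have := H g (- kappa / d.+1%:R) g_supp g_n0 g0.
rewrite ler_pdivlMr// lerNr [b * _]mulrC => -> // v.
rewrite [_ * (_ / _)]mulrC divfK ?pnatr_eq0// !mulNr -gE -sumrN; apply: eq_bigr => u _.
by rewrite B_sym /B !mulNr opprK.
Qed.

Lemma trickle_le F d b : uniform F d.+3 -> rigid F -> 0 <= b < 1 ->
  (forall w, spectral_le (lk F w) d.+1 b) -> spectral_le F d.+2 (b / (1 - b)).
Proof.
move=> Fd Frig /andP[b0 b1] H; apply: (spectral_le_eigen Fd).
move=> f kappa f_supp f_n0 f0 fE.
have kappa_lt1 : kappa < 1.
  have := eigenvalue_lt Fd Frig f_supp f_n0 f0 fE.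
  by rewrite gtr_pMr.
set N := vsum F (fun v => f v ^+ 2).
have N_gt0 : 0 < N.
  have [v fv] := f_n0; rewrite /N /vsum (bigD1 v)//= ltr_wpDr//.
    by rewrite sumr_ge0// => u _; rewrite mulr_ge0 ?sqr_ge0.
  rewrite mulr_gt0 ?exprn_even_gt0// ltr0n lt0n.
  by apply: contraNneq fv => m0; rewrite f_supp// m0.
have qE : qform F f f = d.+2%:R * kappa * N.
  rewrite mulr_sumr; apply: eq_bigr => v _; rewrite fE; ring.
have key : qform F f f <= d.+2%:R * (b * N + (1 - b) * (kappa ^+ 2 * N)).
  rewrite -(ler_pM2l (ltr0Sn R d)) -(qform_link _ _ Fd).
  have -> : d.+1%:R * (d.+2%:R * (b * N + (1 - b) * (kappa ^+ 2 * N))) =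
      \sum_w d.+1%:R * (b * vsum (lk F w) (fun v => f v ^+ 2) +
       (1 - b) * (d.+2%:R * (kappa ^+ 2 * (#|lk F w|%:R * f w ^+ 2)))).
    rewrite -mulr_sumr big_split /= -!mulr_sumr (vsum_link _ Fd) -/N.
    by rewrite -/(vsum F (fun v => f v ^+ 2)) -/N; ring.
  apply: ler_sum => w _.
  have [c cE] := spectral_le_mean f (uniform_lk w Fd) (H w).
  move=> /le_trans; apply; rewrite ler_pM2l// lerD2l ler_pM2l ?subr_gt0//.
  have [m0|m0] := eqVneq #|lk F w| 0%N.
    by rewrite m0 muln0 mul0r !mulr0.
  (* The eigenvalue equation at [w] says that [f] has mean [kappa * f w] on the link of [w]. *)
  have -> : c = kappa * f w.
    have W0 : (d.+2 * #|lk F w|)%:R != 0 :> R by rewrite pnatr_eq0 muln_eq0.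
    apply: (mulIf W0); rewrite -cE fE natrM; ring.
  by rewrite natrM le_eqVlt; apply/orP; left; apply/eqP; ring.
rewrite qE -mulrA ler_pM2l// in key.
have {key} key : kappa <= b + (1 - b) * kappa ^+ 2.
  by rewrite -(ler_pM2r N_gt0) mulrDl -[(1 - b) * _ * N]mulrA.
(* [key] factors as [(1 - kappa) * (b - (1 - b) * kappa) >= 0]. *)
rewrite ler_pdivlMr ?subr_gt0//; nra.
Qed.

(** The map [x / (1 - x)] of [trickle_le] sends [b / (1 - i b)] to [b / (1 - (i + 1) b)], where [i]
    counts the levels above the links of codimension 2. *)
Lemma trickling_down (b : R) (j : nat) F : 0 <= b -> j%:R * b < 1 ->
  uniform F j.+2 ->
  (forall vs, (size vs <= j)%N -> rigid (foldl lk F vs)) ->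
  (forall vs, size vs = j ->
     spectral_le (foldl lk F vs) 1 b /\ spectral_ge (foldl lk F vs) 1 (- b)) ->
  forall vs, (size vs <= j)%N -> let i := (j - size vs)%N in
    spectral_le (foldl lk F vs) i.+1 (b / (1 - i%:R * b)) /\
    spectral_ge (foldl lk F vs) i.+1 (- b).
Proof.
move=> b0; elim: j F => [|j IHj] F jb Fj Frig base.
  case=> // _ /=; have [] := base [::] erefl.
  by rewrite mul0r subr0 divr1.
have jb' : j%:R * b < 1 by apply: le_lt_trans jb; rewrite ler_wpM2r// ler_nat.
have IHw w := IHj (lk F w) jb' (uniform_lk w Fj)
  (fun vs => Frig (w :: vs)) (fun vs szj => base (w :: vs) (congr1 S szj)).
case=> [_|w vs]; last by move=> szvs; exact: (IHw w vs).
have jb1 : 0 < 1 - j%:R * b by rewrite subr_gt0.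
have jb2 : 0 < 1 - (1 + j%:R) * b by rewrite subr_gt0 -nat1r in jb *.
rewrite subn0 /=; split; last first.
  apply: trickle_ge Fj _ _ => [|w]; first by lra.
  by have [] := IHw w [::] isT; rewrite subn0.
have -> : b / (1 - j.+1%:R * b) =
    b / (1 - j%:R * b) / (1 - b / (1 - j%:R * b)).
  by rewrite -nat1r; field; rewrite !gt_eqF//; lra.
apply: trickle_le Fj (Frig [::] isT) _ _ => [|w].
  apply/andP; split; first by rewrite divr_ge0// ltW.
  by rewrite ltr_pdivrMr//; lra.
by have [] := IHw w [::] isT; rewrite subn0.
Qed.

End Trickling.

(** * Mixing *)

Section Decorrelation.
Variables (R : realType) (T : finType) (p : T -> R) (lambda : R).
Hypothesis p_ge0 : forall v, 0 <= p v.
Hypothesis p_sum1 : \sum_v p v = 1.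
Hypothesis lambda_ge0 : 0 <= lambda.
Hypothesis lambda_le1 : lambda <= 1.

Let E (f : T -> R) := \sum_v p v * f v.

Let eqE f g : f =1 g -> E f = E g.
Proof. by move=> fg; apply: eq_bigr => v _; rewrite fg. Qed.

Let ED f g : E (fun v => f v + g v) = E f + E g.
Proof. by rewrite -big_split; apply: eq_bigr => v _; rewrite mulrDr. Qed.

Let EZ c f : E (fun v => c * f v) = c * E f.
Proof. by rewrite mulr_sumr; apply: eq_bigr => v _; rewrite mulrCA. Qed.

Let E1 : E (fun=> 1) = 1.
Proof. by rewrite -[RHS]p_sum1; apply: eq_bigr => v _; rewrite mulr1. Qed.

Let E_ge0 f : (forall v, 0 <= f v) -> 0 <= E f.
Proof. by move=> f0; rewrite sumr_ge0// => v _; rewrite mulr_ge0. Qed.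

Let E_le f g : (forall v, f v <= g v) -> E f <= E g.
Proof. by move=> fg; apply: ler_sum => v _; rewrite ler_wpM2l. Qed.

Lemma cauchy_schwarz f g a c : E (fun v => f v ^+ 2) <= a ->
  E (fun v => g v ^+ 2) <= c -> `|E (fun v => f v * g v)| <= Num.sqrt (a * c).
Proof.
move=> fa gc; rewrite -sqrtr_sqr ler_wsqrtr//.
have f0 : 0 <= E (fun v => f v ^+ 2) by apply: E_ge0 => v; exact: sqr_ge0.
have g0 : 0 <= E (fun v => g v ^+ 2) by apply: E_ge0 => v; exact: sqr_ge0.
apply: le_trans (ler_pM f0 g0 fa gc).
(* Lagrange's identity. *)
have : 0 <= \sum_u \sum_v p u * p v * (f u * g v - f v * g u) ^+ 2.
  rewrite sumr_ge0// => u _; rewrite sumr_ge0// => v _.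
  by apply: mulr_ge0 (sqr_ge0 _); exact: mulr_ge0.
suff -> : \sum_u \sum_v p u * p v * (f u * g v - f v * g u) ^+ 2 =
    2 * (E (fun v => f v ^+ 2) * E (fun v => g v ^+ 2) -
         E (fun v => f v * g v) ^+ 2) by nra.
have EM h k : E h * E k = \sum_u \sum_v p u * h u * (p v * k v).
  by rewrite mulr_suml; apply: eq_bigr => u _; rewrite mulr_sumr.
rewrite mulrBr !mulr_natl !mulr2n -{2}[_ * E (fun v => g v ^+ 2)]mulrC expr2.
rewrite !EM -!big_split -sumrB; apply: eq_bigr => u _ /=.
rewrite -!big_split -sumrB; apply: eq_bigr => v _ /=; ring.
Qed.

Definition unit_valued (f : T -> R) := forall v, 0 <= f v <= 1.

(** A variance bound. Having the mean on the right, and not 1, is what produces square roots of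
    means in the errors below. *)
Definition concentrated (a : T -> R) :=
  E (fun v => (a v - E a) ^+ 2) <= lambda ^+ 2 * E a.

Let E_unit f : unit_valued f -> 0 <= E f <= 1.
Proof.
move=> f01; rewrite E_ge0 => [|v]; last by case/andP: (f01 v).
by rewrite -[leRHS]E1 E_le// => v; case/andP: (f01 v).
Qed.

Lemma unit_valued_sqr f v : unit_valued f -> f v ^+ 2 <= f v.
Proof. by move=> /(_ v) /andP[f0 f1]; rewrite expr2 ler_piMr. Qed.

Lemma unit_valued_prod (I : Type) (s : seq I) (a : I -> T -> R) :
  (forall i, unit_valued (a i)) -> unit_valued (fun v => \prod_(i <- s) a i v).
Proof.
move=> a01 v; elim/big_ind: _ => [|x y /andP[x0 x1] /andP[y0 y1]|i _].
- by rewrite ler01 lexx.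
- by rewrite mulr_ge0// mulr_ile1.
- exact: a01.
Qed.

Lemma unit_valuedM f g : unit_valued f -> unit_valued g ->
  unit_valued (fun v => f v * g v).
Proof.
move=> f01 g01 v; case/andP: (f01 v) => ? ?; case/andP: (g01 v) => ? ?.
by rewrite mulr_ge0// mulr_ile1.
Qed.

Let decorrelate f a :
  E (fun v => f v * a v) - E f * E a = E (fun v => f v * (a v - E a)).
Proof.
rewrite mulrC -mulN1r mulrA -EZ -ED; apply: eqE => v; ring.
Qed.

(** Cauchy-Schwarz for [f] against [a - E a], using [f ^+ 2 <= f]. *)
Lemma decorrelate1 f a : unit_valued f -> 0 <= E a -> concentrated a ->
  `|E (fun v => f v * a v) - E f * E a| <= lambda * Num.sqrt (E f * E a).
Proof.
move=> f01 a0 ca; rewrite decorrelate.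
have -> : lambda * Num.sqrt (E f * E a) = Num.sqrt (E f * (lambda ^+ 2 * E a)).
  by rewrite mulrCA [RHS]sqrtrM ?sqr_ge0// sqrtr_sqr ger0_norm.
by apply: cauchy_schwarz => //; apply: E_le => v; exact: unit_valued_sqr.
Qed.

(** Means replace the factors one at a time, at cost [lambda] each; [h] absorbs the factors not yet
    replaced. *)
Lemma decorrelate_prod (I : Type) (s : seq I) (a : I -> T -> R) h :
  unit_valued h -> (forall i, unit_valued (a i)) ->
  (forall i, concentrated (a i)) ->
  `|E (fun v => h v * \prod_(i <- s) a i v) - E h * \prod_(i <- s) E (a i)| <=
    (size s)%:R * lambda.
Proof.
move=> h01 a01 ca; elim: s h h01 => [|i s IHs] h h01.
  rewrite big_nil mulr1 (@eqE _ h) => [|v]; last by rewrite big_nil mulr1.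
  by rewrite subrr normr0 mul0r.
have := IHs _ (unit_valuedM h01 (a01 i)).
rewrite (@eqE _ (fun v => h v * \prod_(j <- i :: s) a j v)); last first.
  by move=> v; rewrite big_cons mulrA.
set X := E (fun v => h v * \prod_(j <- i :: s) a j v) => IH.
case/andP: (E_unit h01) => h0 h1; case/andP: (E_unit (a01 i)) => a0 a1.
have := decorrelate1 h01 a0 (ca i).
set Y := E (fun v => h v * a i v) in IH * => HY.
have {}HY : `|Y - E h * E (a i)| <= lambda.
  apply: le_trans HY _; rewrite ler_piMr// -[leRHS]sqrtr1 ler_wsqrtr//.
  by rewrite mulr_ile1.
have /andP[Z0 Z1] : 0 <= \prod_(j <- s) E (a j) <= 1.
  elim/big_ind: _ => [|x y /andP[x0 x1] /andP[y0 y1]|j _].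
  - by rewrite ler01 lexx.
  - by rewrite mulr_ge0// mulr_ile1.
  - exact: E_unit.
rewrite big_cons; set Z := \prod_(j <- s) _ in IH Z0 Z1 *.
have -> : X - E h * (E (a i) * Z) = (X - Y * Z) + (Y - E h * E (a i)) * Z by ring.
apply: le_trans (ler_normD _ _) _; rewrite /= -natr1 [leRHS]mulrDl mul1r.
apply: lerD => //; rewrite normrM (ger0_norm Z0).
by rewrite -[leRHS]mulr1 ler_pM.
Qed.

(** Expanding around the means leaves one product of two fluctuations and two single fluctuations
    multiplied by a mean; each of the three costs at most [lambda * Num.sqrt (E a * E b)]. *)
Lemma decorrelate2 h a b : unit_valued h -> unit_valued a -> unit_valued b ->
  concentrated a -> concentrated b ->
  `|E (fun v => h v * (a v * b v)) - E h * (E a * E b)| <=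
    3 * lambda * Num.sqrt (E a * E b).
Proof.
move=> h01 a01 b01 ca cb.
case/andP: (E_unit a01) => a0 a1; case/andP: (E_unit b01) => b0 b1.
case/andP: (E_unit h01) => h0 h1.
set q := Num.sqrt (E a * E b); have q0 : 0 <= q := sqrtr_ge0 _.
(* A mean outside the root may move inside, as [x ^+ 2 * E h <= x]. *)
have sqrt_le x y : 0 <= x -> x <= 1 -> 0 <= y ->
    x * Num.sqrt (E h * y) <= Num.sqrt (x * y).
  move=> x0 x1 y0; rewrite -{1}[x]ger0_norm// -sqrtr_sqr -sqrtrM ?sqr_ge0//.
  rewrite ler_wsqrtr// mulrA ler_wpM2r// expr2 -mulrA ler_piMr//.
  by rewrite mulr_ile1.
have Hab : `|E (fun v => (h v * (a v - E a)) * (b v - E b))| <= lambda * q.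
  apply: (@le_trans _ _ (lambda ^+ 2 * q)); last first.
    by rewrite ler_wpM2r// expr2 ler_piMr.
  have -> : lambda ^+ 2 * q = Num.sqrt ((lambda ^+ 2 * E a) * (lambda ^+ 2 * E b)).
    rewrite mulrACA sqrtrM ?mulr_ge0 ?sqr_ge0// -expr2 sqrtr_sqr ger0_norm//.
    exact: sqr_ge0.
  apply: cauchy_schwarz => //; apply: le_trans ca; apply: E_le => v.
  rewrite exprMn ler_piMl ?sqr_ge0//; case/andP: (h01 v) => hv0 hv1.
  by rewrite exprn_ile1.
have Ha := decorrelate1 h01 a0 ca; have Hb := decorrelate1 h01 b0 cb.
have -> : E (fun v => h v * (a v * b v)) - E h * (E a * E b) =
  E (fun v => (h v * (a v - E a)) * (b v - E b)) +
  E a * (E (fun v => h v * b v) - E h * E b) +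
  E b * (E (fun v => h v * a v) - E h * E a).
  rewrite (@eqE (fun v => (h v * (a v - E a)) * (b v - E b))
    (fun v => h v * (a v * b v) + ((- E a) * (h v * b v) +
       ((- E b) * (h v * a v) + (E a * E b) * h v)))); last by move=> v; ring.
  by rewrite !ED !EZ; ring.
have -> : 3 * lambda * q = lambda * q + lambda * q + lambda * q by ring.
apply: le_trans (ler_normD _ _) _; apply: lerD.
  apply: le_trans (ler_normD _ _) _; apply: lerD => //.
  rewrite normrM (ger0_norm a0); apply: le_trans (ler_wpM2l a0 Hb) _.
  by rewrite mulrCA ler_wpM2l// sqrt_le.
rewrite normrM (ger0_norm b0); apply: le_trans (ler_wpM2l b0 Ha) _.
by rewrite mulrCA ler_wpM2l// /q [E a * E b]mulrC sqrt_le.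
Qed.

(** [b] and [c] are replaced first, with the other factors absorbed in [h]. The error of the
    remaining replacements carries the factor [E b * E c], which is at most its own square root. *)
Lemma decorrelate_all (I : Type) (s : seq I) (a : I -> T -> R) h b c :
  unit_valued h -> (forall i, unit_valued (a i)) ->
  unit_valued b -> unit_valued c ->
  (forall i, concentrated (a i)) -> concentrated b -> concentrated c ->
  `|E (fun v => h v * \prod_(i <- s) a i v * (b v * c v)) -
    E h * \prod_(i <- s) E (a i) * (E b * E c)| <=
    ((size s)%:R + 3) * lambda * Num.sqrt (E b * E c).
Proof.
move=> h01 a01 b01 c01 ca cb cc.
case/andP: (E_unit b01) => b0 b1; case/andP: (E_unit c01) => c0 c1.
have k01 := unit_valuedM h01 (unit_valued_prod s a01).
have H2 := decorrelate2 k01 b01 c01 cb cc.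
have H1 := decorrelate_prod s h01 a01 ca.
set X := E _ in H2 *; set Y := E (fun v => h v * _) in H1 H2.
set Z := E h * _ in H1 *.
have -> : X - Z * (E b * E c) = (X - Y * (E b * E c)) + (Y - Z) * (E b * E c).
  by ring.
apply: le_trans (ler_normD _ _) _.
have -> : ((size s)%:R + 3) * lambda * Num.sqrt (E b * E c) =
  3 * lambda * Num.sqrt (E b * E c) +
  (size s)%:R * lambda * Num.sqrt (E b * E c) by ring.
apply: lerD => //.
have bc0 : 0 <= E b * E c by rewrite mulr_ge0.
rewrite normrM (ger0_norm bc0) ler_pM// -{1}[E b * E c]sqr_sqrtr//.
by rewrite expr2 ler_piMr ?sqrtr_ge0// -[leRHS]sqrtr1 ler_wsqrtr// mulr_ile1.
Qed.

End Decorrelation.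

(** * Conditioning on the first vertex of an ordered facet *)

Section Mixing.
Variables (R : realType) (T : finType).
Implicit Types (F : {set {set T}}) (f g : T -> R).

Definition mean F f : R := vsum F f / vsum F (fun=> 1).

(** The law of a random vertex of a random member of [F], which is the stationary law of the
    walk. *)
Definition link_weight F v : R := #|lk F v|%:R / vsum F (fun=> 1).

Lemma meanE F f : mean F f = \sum_v link_weight F v * f v.
Proof. by rewrite /mean mulr_suml; apply: eq_bigr => v _; rewrite mulrAC. Qed.

Lemma link_weight_ge0 F v : 0 <= link_weight F v.
Proof. by rewrite divr_ge0// vsum_ge0. Qed.

Lemma mean_unit F f : unit_valued f -> 0 <= mean F f <= 1.
Proof.
move=> f01; rewrite /mean; set V := vsum F (fun=> 1).
have V0 : 0 <= V by exact: vsum_ge0.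
rewrite divr_ge0 ?vsum_ge0//= => [|v]; last by case/andP: (f01 v).
have [->|V_neq0] := eqVneq V 0; first by rewrite invr0 mulr0.
rewrite ler_pdivrMr ?mul1r ?lt_def ?V_neq0//.
by apply: ler_sum => v _; rewrite ler_wpM2l//; case/andP: (f01 v).
Qed.

Lemma vsum1_gt0 F d : uniform F d.+1 -> (0 < #|F|)%N -> 0 < vsum F (fun=> 1 : R).
Proof. by move=> Fd F0; rewrite (vsum1 R Fd) ltr0n muln_gt0. Qed.

Lemma sum_link_weight F d : uniform F d.+1 -> (0 < #|F|)%N ->
  \sum_v link_weight F v = 1.
Proof.
move=> Fd F0; rewrite -mulr_suml.
rewrite -[RHS](mulfV (lt0r_neq0 (vsum1_gt0 Fd F0))); congr (_ / _).
by apply: eq_bigr => v _; rewrite mulr1.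
Qed.

Definition spectral_bound F d lambda := forall f, vsum F f = 0 ->
  `|qform F f f| <= d%:R * lambda * vsum F (fun v => f v ^+ 2).

Lemma vsum_mean_link F d f (h : T -> R) : uniform F d.+2 ->
  \sum_v h v * vsum (lk F v) f =
  d.+1%:R * vsum F (fun v => h v * mean (lk F v) f).
Proof.
move=> Fd; rewrite mulr_sumr; apply: eq_bigr => v _.
rewrite [RHS](_ : _ = h v * ((d.+1 * #|lk F v|)%:R * mean (lk F v) f)).
  2: by rewrite natrM; ring.
congr (_ * _).
rewrite /mean (vsum1 R (uniform_lk v Fd)).
have [F0|F0] := eqVneq #|lk F v| 0%N; first by rewrite vsum_empty// mul0r mulr0.
by rewrite mulrC divfK// pnatr_eq0 muln_eq0.
Qed.

(** Stationarity: one step of the walk from a random vertex leads to a random vertex. *)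
Lemma mean_mean F d f : uniform F d.+2 ->
  mean F (fun v => mean (lk F v) f) = mean F f.
Proof.
move=> Fd; congr (_ / _); apply: (@mulfI _ d.+1%:R); first by rewrite pnatr_eq0.
rewrite /= -(vsum_link f Fd).
have := vsum_mean_link f (fun=> 1) Fd.
under eq_bigr do rewrite mul1r; move=> ->; congr (_ * _).
by apply: eq_vsum => v; rewrite mul1r.
Qed.

(** For a self-adjoint operator, a two-sided bound on the form bounds the norm. With [h] the image
    of [g], the forms at [lambda * g + h] and [lambda * g - h] differ by a multiple of the squared
    norm of [h], and the parallelogram law evaluates the sum of the two bounds. *)
Lemma qform_contraction F d (lambda : R) g :
  uniform F d.+2 -> 0 < lambda -> spectral_bound F d.+1 lambda ->
  vsum F g = 0 ->
  vsum F (fun v => mean (lk F v) g ^+ 2) <=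
    lambda ^+ 2 * vsum F (fun v => g v ^+ 2).
Proof.
move=> Fd l_gt0 Fl g0; pose h v := mean (lk F v) g.
have h0 : vsum F h = 0.
  apply: (@mulfI _ d.+1%:R); first by rewrite pnatr_eq0.
  have := vsum_mean_link g (fun=> 1) Fd.
  under eq_bigr do rewrite mul1r; rewrite (vsum_link g Fd) g0 mulr0 => /esym E0.
  by rewrite -[RHS]E0; congr (_ * _); apply: eq_vsum => v; rewrite mul1r.
have hgE : qform F h g = d.+1%:R * vsum F (fun v => h v ^+ 2).
  by rewrite /qform (vsum_mean_link g h Fd).
rewrite -/(h _); have hN : vsum F (fun v => mean (lk F v) g ^+ 2) =
  vsum F (fun v => h v ^+ 2) by [].
rewrite hN; clearbody h; clear hN.
have sqE t : vsum F (fun v => (lambda * g v + t * h v) ^+ 2) =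
    lambda ^+ 2 * vsum F (fun v => g v ^+ 2) +
    (2 * lambda * t * vsum F (fun v => g v * h v) +
     t ^+ 2 * vsum F (fun v => h v ^+ 2)).
  rewrite -!vsumZ -!vsumD; apply: eq_vsum => v; ring.
have Ht t : vsum F (fun v => lambda * g v + t * h v) = 0.
  by rewrite vsumD !vsumZ g0 h0 !mulr0 addr0.
have qE t : qform F (fun v => lambda * g v + t * h v)
                    (fun v => lambda * g v + t * h v) =
    lambda ^+ 2 * qform F g g + 2 * t * lambda * qform F h g +
    t ^+ 2 * qform F h h.
  by rewrite !(qformDl, qformDr, qformZl, qformZr) (qformC F g h); ring.
have := Fl _ (Ht 1); have := Fl _ (Ht (-1)).
rewrite !sqE !qE hgE !ler_norml => /andP[+ _] /andP[_].
have d0 : 0 < d.+1%:R :> R by [].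
have H0 : 0 <= vsum F (fun v => h v ^+ 2) by apply: vsum_ge0 => v; exact: sqr_ge0.
set V := vsum F (fun v => h v ^+ 2); set W := vsum F (fun v => g v ^+ 2).
move=> U1 U2; rewrite -subr_ge0.
have : 0 <= (d.+1%:R * lambda) * (lambda ^+ 2 * W - V) by lra.
by rewrite pmulr_rge0// mulr_gt0.
Qed.

(** The contraction is applied to [f - q], whose mean square is at most [q] because
    [f ^+ 2 <= f]. *)
Lemma concentrated_mean_link F d (lambda : R) f :
  uniform F d.+2 -> (0 < #|F|)%N -> 0 < lambda ->
  spectral_bound F d.+1 lambda -> unit_valued f ->
  concentrated (link_weight F) lambda (fun v => mean (lk F v) f).
Proof.
move=> Fd F0 l_gt0 Fl f01; rewrite /concentrated -!meanE (mean_mean f Fd).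
set q := mean F f.
have V0 := vsum1_gt0 Fd F0.
have qE : vsum F f = q * vsum F (fun=> 1) by rewrite divfK ?gt_eqF.
have fgE : (fun v => f v - q) =1 (fun v => f v + (- q) * 1).
  by move=> v; rewrite mulr1.
have g0 : vsum F (fun v => f v - q) = 0.
  by rewrite (eq_vsum _ fgE) vsumD vsumZ qE; ring.
have := qform_contraction Fd l_gt0 Fl g0.
have -> : vsum F (fun v => mean (lk F v) (fun u => f u - q) ^+ 2) =
          vsum F (fun v => (mean (lk F v) f - q) ^+ 2).
  apply: eq_bigr => v _.
  (* On an empty link [mean] is 0 by default and does not commute with the shift by [q], but the
     vertex has weight 0. *)
  have [->|Fv0] := eqVneq #|lk F v| 0%N; first by rewrite !mul0r.
  congr (_ * _ ^+ 2); rewrite /mean (eq_vsum _ fgE) vsumD vsumZ mulrDl mulfK//.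
  by rewrite gt_eqF// (vsum1_gt0 (uniform_lk v Fd))// lt0n.
move=> H; rewrite /mean ler_pdivrMr//; apply: le_trans H _.
rewrite -[leRHS]mulrA ler_wpM2l ?sqr_ge0// -qE.
rewrite (@eq_vsum _ _ _ _ (fun v => f v ^+ 2 + ((- 2 * q) * f v + q ^+ 2 * 1))).
  2: by move=> v; ring.
rewrite !(vsumD, vsumZ) qE.
have : vsum F (fun v => f v ^+ 2) <= q * vsum F (fun=> 1).
  by rewrite -qE; apply: ler_sum => v _; rewrite ler_wpM2l ?unit_valued_sqr.
have : 0 <= q ^+ 2 * vsum F (fun=> 1) by rewrite mulr_ge0 ?sqr_ge0 ?ltW.
by lra.
Qed.

Variables (I : Type) (a : I -> T -> R).
Hypothesis a_unit : forall i, unit_valued (a i).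

(* Up to the factor |F| (size s)`!, the expectation of the product of the a i over
   the vertices of a random ordered member of F. *)
Fixpoint ordered_count F (s : seq I) : R :=
  if s is i :: s' then \sum_v a i v * ordered_count (lk F v) s'
  else (set0 \in F)%:R.

Lemma ordered_count_empty F s : #|F| = 0%N -> ordered_count F s = 0.
Proof.
elim: s F => [|i s IHs] F F0 /=.
  by move/eqP: F0; rewrite cards_eq0 => /eqP ->; rewrite inE.
by apply: big1 => v _; rewrite IHs ?mulr0// lk_empty.
Qed.

Lemma uniform0 F : uniform F 0 -> #|F| = (set0 \in F).
Proof.
move=> F0; have -> : F = if set0 \in F then [set set0] else set0.
  apply/setP => s; case: ifPn => s0; rewrite inE.
    by apply/idP/eqP => [/F0/cards0_eq|->].
  by apply: contraNF s0 => sF; rewrite -(cards0_eq (F0 _ sF)).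
by case: ifP => _; rewrite ?cards1 ?cards0 inE ?eqxx.
Qed.

Lemma ordered_count1 F i : uniform F 1 -> ordered_count F [:: i] = vsum F (a i).
Proof.
move=> F1; apply: eq_bigr => v _ /=.
by rewrite mulrC (uniform0 (uniform_lk v F1)).
Qed.

(** Error constant with [k] vertices before the distinguished pair: 1 comes from [decorrelate1], and
    each further vertex adds the constant of [decorrelate_all]. *)
Fixpoint mixing_rec (k : nat) : R :=
  if k is k'.+1 then mixing_rec k' + (k'%:R + 3) else 1.

Lemma mixing_rec_ge0 k : 0 <= mixing_rec k.
Proof. by elim: k => //= k IHk; rewrite !addr_ge0. Qed.

(** [W] is the number of ordered members of [F]. In the induction, [W * X] is what the hypothesis
    predicts from the links of the first vertex, and [Y] is the product of the means: [link_err]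
    handles the former, decorrelation the difference [X - Y]. *)
Lemma ordered_mixing F (lambda : R) (s : seq I) (i j : I) :
  0 < lambda <= 1 -> uniform F (size s).+2 ->
  (forall vs, (size vs <= size s)%N ->
    spectral_bound (foldl lk F vs) (size s - size vs).+1 lambda) ->
  forall W : R, W = ((size s).+2`! * #|F|)%:R ->
  `|ordered_count F (s ++ [:: i; j]) - W *
     (\prod_(k <- s) mean F (a k) * (mean F (a i) * mean F (a j)))| <=
  mixing_rec (size s) * lambda * W *
    Num.sqrt (mean F (a i) * mean F (a j)).
Proof.
case/andP=> l_gt0 l_le1.
elim: s F => [|h s IHs] F Fs Fl W WdE.
  have [F0|F0] := posnP #|F|.
    by rewrite ordered_count_empty// WdE F0 muln0 !mul0r subrr normr0 mulr0 mul0r.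
  have Fl0 := Fl [::] isT.
  have WE : W = vsum F (fun=> 1) by rewrite WdE (vsum1 R Fs).
  have W0 : 0 < W by rewrite WE (vsum1_gt0 Fs).
  have -> : ordered_count F ([::] ++ [:: i; j]) =
      W * \sum_v link_weight F v * (a i v * mean (lk F v) (a j)).
    have -> : ordered_count F ([::] ++ [:: i; j]) =
        \sum_v a i v * vsum (lk F v) (a j).
      by apply: eq_bigr => v _; rewrite -(ordered_count1 _ (uniform_lk v Fs)).
    rewrite (vsum_mean_link _ _ Fs) mul1r -meanE WE mulrC divfK//.
    by rewrite -WE gt_eqF.
  rewrite big_nil mul1r -mulrBr normrM (ger0_norm (ltW W0)) /= mul1r.
  rewrite [lambda * W]mulrC -[leRHS]mulrA ler_pM2l//.
  have := @decorrelate1 R T (link_weight F) lambda (link_weight_ge0 F)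
    (ltW l_gt0) (a i) (fun v => mean (lk F v) (a j)) (a_unit i) _
    (concentrated_mean_link Fs F0 l_gt0 Fl0 (a_unit j)).
  rewrite -!meanE (mean_mean _ Fs); apply.
  by case/andP: (mean_unit F (a_unit j)).
have [F0|F0] := posnP #|F|.
  by rewrite ordered_count_empty// WdE F0 muln0 !mul0r subrr normr0 mulr0 mul0r.
have Fl0 := Fl [::] isT.
have V0 := vsum1_gt0 Fs F0.
have W0 : 0 < W by rewrite WdE ltr0n muln_gt0 fact_gt0.
(* The number of ordered members beginning with [v]. *)
have WvE v : ((size s).+2`! * #|lk F v|)%:R = W * link_weight F v.
  rewrite WdE factS /link_weight (vsum1 R Fs) !natrM /=; field.
  by rewrite -natrD !pnatr_eq0 -lt0n F0.
pose A k v := mean (lk F v) (a k).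
have A01 k : unit_valued (A k) by move=> v; exact: mean_unit.
have Ac k : concentrated (link_weight F) lambda (A k).
  exact: concentrated_mean_link Fs F0 l_gt0 Fl0 (a_unit k).
have EA k : \sum_v link_weight F v * A k v = mean F (a k).
  by rewrite -meanE (mean_mean _ Fs).
set q := Num.sqrt _.
pose X := \sum_v link_weight F v *
  (a h v * \prod_(k <- s) A k v * (A i v * A j v)).
pose Y := mean F (a h) * \prod_(k <- s) mean F (a k) *
  (mean F (a i) * mean F (a j)).
have main : `|X - Y| <= ((size s)%:R + 3) * lambda * q.
  have := @decorrelate_all R T (link_weight F) lambda (link_weight_ge0 F)
    (sum_link_weight Fs F0) (ltW l_gt0) l_le1 I s A (a h) (A i) (A j)
    (a_unit h) A01 (A01 i) (A01 j) Ac (Ac i) (Ac j).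
  rewrite !EA -(meanE F (a h)); congr (`|_ - _ * _ * _| <= _).
  by apply: eq_bigr => k _; rewrite EA.
have link_err : `|ordered_count F ((h :: s) ++ [:: i; j]) - W * X| <=
    mixing_rec (size s) * lambda * W * q.
  rewrite /= mulr_sumr -sumrB; apply: le_trans (ler_norm_sum _ _ _) _.
  apply: (@le_trans _ _ (\sum_v mixing_rec (size s) * lambda * W *
      (link_weight F v * (Num.sqrt (A i v) * Num.sqrt (A j v))))).
    apply: ler_sum => v _.
    have := IHs (lk F v) (uniform_lk v Fs) (fun vs => Fl (v :: vs)) _ erefl.
    rewrite /= WvE sqrtrM; last by case/andP: (A01 i v).
    set O := ordered_count _ _ => H.
    have -> : a h v * O - W * (link_weight F v *
        (a h v * \prod_(k <- s) A k v * (A i v * A j v))) =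
      a h v * (O - W * link_weight F v *
        (\prod_(k <- s) A k v * (A i v * A j v))) by ring.
    rewrite normrM; case/andP: (a_unit h v) => ah0 ah1; rewrite (ger0_norm ah0).
    apply: le_trans (ler_piMl (normr_ge0 _) ah1) _.
    by apply: le_trans H _; rewrite !mulrA.
  rewrite -mulr_sumr ler_wpM2l//.
    by rewrite !mulr_ge0 ?mixing_rec_ge0// ltW.
  apply: le_trans (ler_norm _) _.
  (* The square root survives the averaging over [v]: by Cauchy-Schwarz the mean of the geometric
     means is at most the geometric mean of the means. *)
  apply: (@cauchy_schwarz R T (link_weight F) (link_weight_ge0 F)).
    rewrite -EA le_eqVlt; apply/orP; left; apply/eqP.
    by apply: eq_bigr => v _; rewrite sqr_sqrtr//; case/andP: (A01 i v).
  rewrite -EA le_eqVlt; apply/orP; left; apply/eqP.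
  by apply: eq_bigr => v _; rewrite sqr_sqrtr//; case/andP: (A01 j v).
rewrite big_cons.
set O := ordered_count _ _ in link_err *.
have -> : O - W * (mean F (a h) * \prod_(k <- s) mean F (a k) *
   (mean F (a i) * mean F (a j))) = (O - W * X) + W * (X - Y).
  by rewrite /Y; ring.
apply: le_trans (ler_normD _ _) _.
rewrite normrM (ger0_norm (ltW W0)) /=.
have -> : (mixing_rec (size s) + ((size s)%:R + 3)) * lambda * W * q =
  mixing_rec (size s) * lambda * W * q +
  W * (((size s)%:R + 3) * lambda * q) by ring.
by rewrite lerD// ler_pM2l.
Qed.

End Mixing.

(** * Counting transversal members *)

Section TransversalCount.
Variables (R : realType) (T : finType) (I : eqType) (U : I -> {set T}).
Hypothesis U_disjoint : forall i j, i != j -> [disjoint U i & U j].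

Lemma sum_card_setI (s : seq I) (x : {set T}) :
  uniq s -> (\sum_(i <- s) #|x :&: U i| <= #|x|)%N.
Proof.
elim: s x => [|i s IHs] x /=; first by rewrite big_nil.
case/andP=> is_ us; rewrite big_cons -(cardsID (U i) x) leq_add2l.
apply: leq_trans (IHs (x :\: U i) us); rewrite leq_eqVlt; apply/orP; left.
apply/eqP; apply: eq_big_seq => k ks; congr #|pred_of_set _|.
apply/setP => v; rewrite !inE; have [vk|] := boolP (v \in U k); last first.
  by rewrite !andbF.
rewrite (disjointFl (U_disjoint _) vk) ?andbT//.
by apply: contraNneq is_ => ->.
Qed.

(** A transversal member has exactly one ordering that visits the [U i] in the order of [s]. *)
Lemma ordered_count_indicator (F : {set {set T}}) (s : seq I) :
  uniq s -> uniform F (size s) ->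
  ordered_count (fun i v => (v \in U i)%:R : R) F s =
  #|[set x in F | all (fun i => #|x :&: U i| == 1%N) s]|%:R.
Proof.
elim: s F => [|i s IHs] F us Fs.
  rewrite /= -(uniform0 Fs); congr (#|pred_of_set _|%:R).
  by apply/setP => x; rewrite inE andbT.
have us' : uniq s by case/andP: us.
set G := [set x in F | _].
have -> : #|G| = (\sum_(v in U i) #|lk G v|)%N.
  transitivity (\sum_(v in U i) \sum_(x in G) (v \in x))%N; last first.
    apply: eq_bigr => v _; rewrite card_lk -sum1_card big_mkcond /=.
    rewrite [RHS]big_mkcond; apply: eq_bigr => x _; rewrite [in RHS]inE.
    by case: (x \in G); case: (v \in x).
  rewrite exchange_big -sum1_card; apply: eq_bigr => x; rewrite inE /=.
  case/and3P=> _ /eqP <- _; rewrite -sum1_card big_mkcond [RHS]big_mkcond.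
  by apply: eq_bigr => v _; rewrite inE andbC; case: (v \in U i); case: (v \in x).
rewrite /= natr_sum [RHS]big_mkcond; apply: eq_bigr => v _.
case: ifPn => vi; last by rewrite mul0r.
rewrite mul1r (IHs (lk F v) us' (uniform_lk v Fs)).
congr (#|pred_of_set _|%:R); apply/setP => x; rewrite !inE -!andbA.
have [vx|vx] := boolP (v \in x) => //=.
have [xF|] := boolP (v |: x \in F) => //=.
have xs : #|x| = size s by move: (Fs _ xF); rewrite cardsU1 vx => -[].
have E k : k \in s -> #|(v |: x) :&: U k| = #|x :&: U k|.
  move=> ks; congr #|pred_of_set _|; apply/setP => w; rewrite !inE.
  have [->|//] := eqVneq w v.
  rewrite (disjointFr (U_disjoint _) vi) ?andbF//.
  by apply: contraTneq us => ->; rewrite /= ks.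
have -> : all (fun k => #|(v |: x) :&: U k| == 1%N) s =
          all (fun k => #|x :&: U k| == 1%N) s.
  by apply: eq_in_all => k /E ->.
have [xall|_] := boolP (all _ s); last by rewrite andbF.
(* The sets of [s] already account for all [size s] elements of [x], so [x] misses [U i]. *)
have := sum_card_setI x us; rewrite big_cons xs.
rewrite (eq_big_seq (fun=> 1%N)) => [|k ks]; last exact/eqP/(allP xall).
rewrite sum1_size -{2}[size s]add0n leq_add2r leqn0 cards_eq0 => /eqP xi0.
rewrite setIUl xi0 setU0 (_ : [set v] :&: U i = [set v]) ?cards1//.
by apply/setIidPl; rewrite sub1set.
Qed.

End TransversalCount.

(** Both sides are 1 at [n = 0]. The next step adds [n + 3] on the left; on the right the new term
    is [n + 2], and the larger exponents raise each old term by at least 1. *)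
Lemma mixing_rec_le (R : realType) n : mixing_rec R n <= mixing_const R n.+1.
Proof.
elim: n => [|n IHn].
  by rewrite /mixing_const big_ord_recl big_ord0 /= !expr1n mul1r expr1; lra.
rewrite /= [mixing_const R n.+2]/mixing_const big_ord_recr /=.
rewrite subSnn expr1 expr2.
have : mixing_const R n.+1 + 1 <=
    \sum_(k < n.+1) (k.+1%:R * k.+2%:R ^+ (n.+2 - k) - k.+1%:R ^+ (n.+2 - k).+1).
  apply: (@le_trans _ _ (\sum_(k < n.+1)
    (k.+1%:R * k.+2%:R ^+ (n.+1 - k) - k.+1%:R ^+ (n.+1 - k).+1 + 1))).
    rewrite big_split lerD2l /= sumr_const card_ord.
    by rewrite -[leLHS]mulr1n ler_wpMn2l.
  apply: ler_sum => k _; rewrite [in leRHS]subSn; last exact/ltnW/ltn_ord.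
  set m := (n.+1 - k)%N.
  rewrite (exprS k.+2%:R) (exprS k.+1%:R m.+1) (exprS k.+1%:R m).
  have : k.+1%:R ^+ m <= k.+2%:R ^+ m :> R by rewrite lerXn2r ?nnegrE ?ler_nat.
  have : 1 <= k.+1%:R ^+ m :> R by rewrite exprn_ege1 ?ler1n.
  (* A term grows by [(k + 1) * ((k + 1) * A - k * B)], where [A >= B >= 1]. *)
  set A : R := k.+2%:R ^+ m; set B : R := k.+1%:R ^+ m.
  have : 0 <= k%:R :> R by [].
  rewrite -![in k.+2%:R]natr1 -natr1; set x : R := k%:R.
  nra.
have n2 : n.+2%:R = n%:R + 2 :> R by rewrite -addn2 natrD.
have n3 : n.+3%:R = n%:R + 3 :> R by rewrite -addn3 natrD.
rewrite n2 n3; lra.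
Qed.

(** * Simplicial complexes *)

Section Complexes.
Variables (T : finType) (X : {set {set T}}).
Hypothesis X_complex : simplicial_complex X.
Implicit Types (s t : {set T}) (u v : T).

Lemma in_faces s (d : nat) k : k = d%:Z - 1 ->
  (s \in faces X k) = (s \in X) && (#|s| == d).
Proof. by move=> ->; rewrite inE /sdim (inj_eq (addIr _)) eqz_nat. Qed.

Lemma complex_sub s s' : s \in X -> s' \subset s -> s' \in X.
Proof. by case: X_complex => _; apply. Qed.

Lemma in_link t s :
  (s \in link X t) = (t :|: s \in X) && [disjoint t & s].
Proof.
rewrite inE (@in_faces _ (#|t| + #|s|)); last first.
  by rewrite /sdim PoszD; ring.
rewrite (leq_card_setU t s).
case: (boolP (t :|: s \in X)) => [tsX|_]; last by rewrite andbF.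
by rewrite (complex_sub tsX (subsetUr _ _)).
Qed.

Lemma link_complex t : t \in X -> simplicial_complex (link X t).
Proof.
move=> tX; split=> [|s s']; rewrite !in_link.
  by rewrite setU0 tX -setI_eq0 setI0 eqxx.
case/andP=> tsX dts ss'; rewrite (complex_sub tsX) ?setUS//=.
by apply: disjointWr dts.
Qed.

Lemma vertices_sub s v : s \in X -> v \in s -> v \in vertices X.
Proof.
move=> sX vs; rewrite inE (@in_faces _ 1)// cards1 andbT.
by apply: complex_sub sX _; rewrite sub1set.
Qed.

Lemma uniform_faces (d : nat) k : k = d%:Z - 1 -> uniform (faces X k) d.
Proof. by move=> kE s; rewrite (in_faces _ kE) => /andP[_ /eqP]. Qed.

Lemma card_lk_adj u v : #|lk (lk (faces X 1) u) v| = adj X u v.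
Proof.
have F2 : uniform (faces X 1) 2 by exact: uniform_faces.
rewrite /adj; set F := faces X 1 in F2 *.
rewrite (uniform0 (uniform_lk v (uniform_lk u F2))) !inE /= setU0.
have [->|//] := eqVneq u v.
have : [set v; v] \notin F.
  by apply/negP => vvF; have := F2 _ vvF; rewrite cards2 eqxx.
by rewrite inE => /negbTE ->.
Qed.

Lemma degreeE v : degree X v = #|lk (faces X 1) v|.
Proof.
have F2 : uniform (faces X 1) 2 by exact: uniform_faces.
rewrite -[RHS]mul1n -(sum_card_lk (uniform_lk v F2)) /degree -sum1_card.
rewrite big_mkcond; apply: eq_bigr => u _; rewrite lkC card_lk_adj in_set.
by case: (adj X u v).
Qed.

(** On a graph the vertex weights are the degrees, so dividing by them gives the eigenvalue equation
    of the simple walk. At isolated vertices the inverse degree is 0 by default and [f] vanishes. *)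
Lemma walk_eigenvalue (R : realType) (f : T -> R) (kappa : R) :
  (forall v, #|lk (faces X 1) v|%:R = 0 :> R -> f v = 0) ->
  (exists v, f v != 0) ->
  (forall v, vsum (lk (faces X 1) v) f = kappa * #|lk (faces X 1) v|%:R * f v) ->
  passmx.leigenvalue (walk_op R X) kappa.
Proof.
set F := faces X 1 => f_supp [v0 fv0] fE.
have lk_vertex v : #|lk F v| != 0%N -> v \in vertices X.
  rewrite card_lk cards_eq0 => /set0Pn[s /setIdP[/setIdP[sX _]]].
  exact: vertices_sub sX.
pose phi : {ffun vertex X -> R^o} := [ffun v => f (val v)].
have phi_ker : phi \in passmx.leigenspace (walk_op R X) kappa.
  rewrite memv_ker add_lfunE opp_lfunE scale_lfunE id_lfunE lfunE /= subr_eq0.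
  apply/eqP/ffunP => v; rewrite !ffunE degreeE.
  have [m0|m0] := eqVneq #|lk F (val v)| 0%N.
    by rewrite m0 invr0 scale0r f_supp ?scaler0// m0.
  have -> : \sum_(u : vertex X | adj X (val u) (val v)) phi u =
            vsum (lk F (val v)) f.
    rewrite /vsum (bigID [pred u | u \in vertices X]) /=.
    rewrite [X in _ = _ + X]big1 ?addr0 => [|u uX]; last first.
      rewrite lkC; have [m1|/lk_vertex] := eqVneq #|lk F u| 0%N.
        by rewrite lk_empty// mul0r.
      by rewrite (negPf uX).
    rewrite (eq_bigr (fun u : vertex X => f (val u))) => [|u _]; last by rewrite ffunE.
    rewrite -(big_sub_cond [in vertices X] (fun u => adj X u (val v)) f) /=.
    rewrite big_mkcondr; apply: eq_bigr => u _.
    by rewrite lkC card_lk_adj; case: ifP; rewrite ?mul1r ?mul0r.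
  by rewrite fE /GRing.scale /= mulrCA mulrA; field; rewrite pnatr_eq0.
have m0 : #|lk F v0| != 0%N by apply: contraNneq fv0 => m0; rewrite f_supp// m0.
apply: contraNneq fv0 => ker0; rewrite ker0 memv0 in phi_ker.
have := congr1 (fun g : {ffun vertex X -> R^o} => g (Sub v0 (lk_vertex _ m0)))
  (eqP phi_ker).
by rewrite !ffunE /= => ->.
Qed.

End Complexes.

Section IteratedLinks.
Variable T : finType.
Implicit Types (F : {set {set T}}) (vs : seq T) (s : {set T}).

(* Iterating lk along a sequence with repetitions yields the empty family. *)
Lemma in_foldl_lk F vs s : (s \in foldl lk F vs) =
  [&& uniq vs, [disjoint [set:: vs] & s] & [set:: vs] :|: s \in F].
Proof.
elim: vs F => [|v vs IHvs] F /=.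
  by rewrite set_nil -setI_eq0 set0I eqxx set0U.
rewrite IHvs in_set in_setU inE negb_or set_cons -setUA.
have -> : [disjoint v |: [set:: vs] & s] = (v \notin s) && [disjoint [set:: vs] & s].
  by rewrite -!setI_eq0 setIUl setU_eq0 setI_eq0 disjoints1.
by case: (v \in vs); case: (uniq vs); case: (v \in s);
  case: [disjoint _ & s]; rewrite ?andbF.
Qed.

Lemma uniform_foldl_lk F vs d :
  uniform F (size vs + d) -> uniform (foldl lk F vs) d.
Proof. by elim: vs F => //= v vs IHvs F Fd; exact/IHvs/uniform_lk. Qed.

End IteratedLinks.

(** * From the link graphs to the spectra of all links *)

Section LinkSpectra.
Variables (R : realType) (T : finType) (X : {set {set T}}) (j : nat).
Hypothesis X_complex : simplicial_complex X.
Hypothesis X_pure : pure X j.+1.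
Hypothesis X_links : connected_links X j.+1.

Let F := faces X j.+1.

Let in_F s : (s \in F) = (s \in X) && (#|s| == j.+2).
Proof. apply: in_faces; lia. Qed.

(** Along a path in the link of [t], purity extends each edge together with [t] to a facet [r], and
    [r :\: t] is a member of the iterated link containing that edge. *)
Lemma rigid_iterated_link vs : (size vs <= j)%N -> rigid R (foldl lk F vs).
Proof.
move=> vsj f f_const s s' u v sF s'F us vs'.
pose t := [set:: vs].
move: (sF) (s'F); rewrite !in_foldl_lk -/t.
case/and3P=> uvs dts tsF /and3P[_ dts' ts'F].
have [tsX ts'X] : t :|: s \in X /\ t :|: s' \in X.
  by move: tsF ts'F; rewrite !in_F => /andP[-> _] /andP[-> _].
have tX : t \in X by exact: complex_sub X_complex _ _ tsX (subsetUl _ _).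
have card_t : #|t| = size vs by rewrite cardsE; exact/card_uniqP.
have tdim : -1 <= sdim t <= j.+1%:Z - 2.
  by rewrite /sdim card_t; move: vsj; clear; lia.
have vertex w r : t :|: r \in X -> [disjoint t & r] -> w \in r ->
    w \in vertices (link X t).
  move=> trX dtr wr; apply: (@vertices_sub _ _ (link_complex X_complex tX) r) => //.
  by rewrite in_link// trX.
have tF : t \in faces X (sdim t) by rewrite inE tX eqxx.
have /connectP[p pp ->] := X_links tdim tF (vertex _ _ tsX dts us)
  (vertex _ _ ts'X dts' vs').
elim: p u {us} pp => //= w p IHp u /andP[uw /IHp <-].
move: uw; rewrite /adj (@in_faces _ _ _ 2)// in_link// => /andP[/andP[tuwX dtuw] _].
have [r rF tuw] := X_pure tuwX.
have tr : t \subset r by apply: subset_trans tuw; exact: subsetUl.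
apply: (f_const (r :\: t)); rewrite ?in_foldl_lk -/t.
- rewrite uvs disjoint_sym disjoints_subset setDE subsetIr -setDE /=.
  by rewrite -{1}(setIidPr tr) setID.
- rewrite inE (disjointFl dtuw) ?inE ?eqxx//=.
  by apply: (subsetP tuw); rewrite !inE eqxx orbT.
- rewrite inE (disjointFl dtuw) ?inE ?eqxx ?orbT//=.
  by apply: (subsetP tuw); rewrite !inE eqxx !orbT.
Qed.

Lemma foldl_lk_faces vs : uniq vs -> size vs = j -> [set:: vs] \in X ->
  foldl lk F vs = faces (link X [set:: vs]) 1.
Proof.
move=> uvs szvs tX; apply/setP => s; rewrite in_foldl_lk uvs /=.
rewrite in_F (@in_faces _ _ _ 2)// in_link// -andbA andbCA.
congr (_ && _); have [dts|//] := boolP [disjoint _ & _].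
have /eqP -> : #|[set:: vs] :|: s| == #|[set:: vs]| + #|s| :> nat.
  by rewrite (leq_card_setU _ _).
have -> : #|[set:: vs]| = j by rewrite -szvs cardsE; exact/card_uniqP.
by rewrite -addn2 eqn_add2l.
Qed.

(** By connectedness an eigenfunction of mean zero has eigenvalue below 1, which rules out the
    exceptional point of the spectrum. If [vs] has repetitions or is not a face, the family is empty
    and carries no such eigenfunction. *)
Lemma base_spectra (b : R) :
  (forall t, t \in faces X (j.+1%:Z - 2) ->
     forall a : R, passmx.leigenvalue (walk_op R (link X t)) a ->
     a \in `[- b, b] \/ a = 1) ->
  forall vs, size vs = j ->
  spectral_le (foldl lk F vs) 1 b /\ spectral_ge (foldl lk F vs) 1 (- b).
Proof.
move=> X_spectrum vs szvs.
have F2 : uniform (foldl lk F vs) 2.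
  apply: uniform_foldl_lk; rewrite szvs addn2.
  apply: uniform_faces; lia.
suff eigen (f : T -> R) kappa :
    (forall v, #|lk (foldl lk F vs) v|%:R = 0 :> R -> f v = 0) ->
    (exists v, f v != 0) -> vsum (foldl lk F vs) f = 0 ->
    (forall v, vsum (lk (foldl lk F vs) v) f =
       1%:R * kappa * #|lk (foldl lk F vs) v|%:R * f v) -> - b <= kappa <= b.
  split.
    apply: spectral_le_eigen F2 _ => f kappa f1 f2 f3 f4.
    by have /andP[] := eigen f kappa f1 f2 f3 f4.
  apply: spectral_ge_eigen F2 _ => f kappa f1 f2 f3 f4.
  by have /andP[] := eigen f kappa f1 f2 f3 f4.
move=> f_supp f_n0 f0 fE.
have {}fE v : vsum (lk (foldl lk F vs) v) f =
    kappa * #|lk (foldl lk F vs) v|%:R * f v by rewrite fE mul1r.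
have kappa1 : kappa < 1.
  apply: eigenvalue_lt F2 _ f_supp f_n0 f0 fE.
  by apply: rigid_iterated_link; rewrite szvs.
have [v0 fv0] := f_n0.
have [s] : exists s, s \in foldl lk F vs.
  have : #|lk (foldl lk F vs) v0| != 0%N.
    by apply: contraNneq fv0 => m0; rewrite f_supp// m0.
  by rewrite card_lk cards_eq0 => /set0Pn[s /setIdP[sF _]]; exists s.
rewrite in_foldl_lk in_F => /and3P[uvs _ /andP[tsX _]].
have tX : [set:: vs] \in X by exact: complex_sub X_complex _ _ tsX (subsetUl _ _).
have GE := foldl_lk_faces uvs szvs tX.
rewrite GE in f_supp fE.
have := walk_eigenvalue (link_complex X_complex tX) f_supp f_n0 fE.
have tF : [set:: vs] \in faces X (j.+1%:Z - 2).
  rewrite (@in_faces _ _ _ j); last lia.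
  by rewrite tX -szvs cardsE; apply/eqP/card_uniqP.
move=> /(X_spectrum _ tF)[|k1]; first by rewrite in_itv.
by rewrite k1 ltxx in kappa1.
Qed.

Lemma link_spectral_bounds (lambda : R) : 0 < lambda ->
  (forall t, t \in faces X (j.+1%:Z - 2) ->
     forall a : R, passmx.leigenvalue (walk_op R (link X t)) a ->
     a \in `[- (lambda / (1 + j%:R * lambda)), lambda / (1 + j%:R * lambda)]
     \/ a = 1) ->
  forall vs, (size vs <= j)%N ->
  spectral_bound (foldl lk F vs) (j - size vs).+1 lambda.
Proof.
move=> l_gt0 X_spectrum vs vsj.
pose b := lambda / (1 + j%:R * lambda).
have den_gt0 : 0 < 1 + j%:R * lambda by rewrite ltr_wpDr// mulr_ge0// ltW.
have b_ge0 : 0 <= b by rewrite divr_ge0// ltW.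
have bE : b * (1 + j%:R * lambda) = lambda by rewrite divfK// gt_eqF.
(* Hence [b / (1 - j b)] is exactly [lambda], which explains the bound assumed on the link graphs;
   levels [i <= j] give no larger bound. *)
have jb : 1 - j%:R * b = (1 + j%:R * lambda)^-1 by rewrite /b; field; rewrite gt_eqF.
have jb1 : 0 < 1 - j%:R * b by rewrite jb invr_gt0.
have F2 : uniform F j.+2 by apply: uniform_faces; lia.
have jb1' : j%:R * b < 1 by rewrite -subr_gt0.
have [] := trickling_down b_ge0 jb1' F2 (@rigid_iterated_link)
  (base_spectra X_spectrum) vsj.
set i := (j - size vs)%N => Hle Hge.
have ib : i%:R * b <= j%:R * b by rewrite ler_wpM2r// ler_nat leq_subr.
have ib1 : 0 < 1 - i%:R * b by apply: lt_le_trans jb1 _; lra.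
have {}Hle : spectral_le (foldl lk F vs) i.+1 lambda.
  apply: spectral_leW Hle; rewrite ler_pdivrMr//.
  apply: (@le_trans _ _ (lambda * (1 - j%:R * b))); first by rewrite jb.
  by rewrite ler_pM2l//; lra.
have {}Hge : spectral_ge (foldl lk F vs) i.+1 (- lambda).
  apply: spectral_geW Hge; rewrite lerN2 -[leRHS]mulr1 /b.
  by rewrite ler_pdivrMr// mulr1 ler_peMr// ?lerDl ?mulr_ge0// ltW.
move=> f f0; rewrite ler_norml Hle// andbT -mulNr -mulrN.
exact: Hge.
Qed.

End LinkSpectra.

(** * Uniform vertex weights in regular complexes *)

Section RegularMean.
Variables (R : realType) (T : finType) (X : {set {set T}}) (n K : nat).
Hypothesis X_complex : simplicial_complex X.
Hypothesis X_regular : regular X n K.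

Lemma vsum_indicator (A : {set T}) : A \subset vertices X ->
  vsum (faces X n) (fun v => (v \in A)%:R : R) = K%:R * #|A|%:R.
Proof.
move=> AX; rewrite -sum1_card natr_sum mulr_sumr [RHS]big_mkcond.
apply: eq_bigr => v _; case: ifPn => vA; last by rewrite mulr0.
by rewrite card_lk X_regular// (subsetP AX).
Qed.

Lemma vsum1_faces : vsum (faces X n) (fun=> 1) = K%:R * #|vertices X|%:R :> R.
Proof.
rewrite -(vsum_indicator (subxx _)); apply: eq_bigr => v _.
have [//|vX] := boolP (v \in vertices X).
suff -> : #|lk (faces X n) v| = 0%N by rewrite !mul0r.
apply/eqP/lk_eq0P => s /setIdP[sX _]; apply: contra vX.
exact: vertices_sub sX.
Qed.

Lemma mean_indicator (A : {set T}) : (0 < K)%N -> A \subset vertices X ->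
  mean (faces X n) (fun v => (v \in A)%:R : R) = #|A|%:R / #|vertices X|%:R.
Proof.
move=> K_gt0 AX; rewrite /mean vsum_indicator// vsum1_faces.
by rewrite -mulf_div divff ?mul1r// pnatr_eq0 -lt0n.
Qed.

End RegularMean.

(** The count does not depend on the order of the sets, so [ordered_mixing] may be applied to an
    enumeration ending with any chosen pair [i1], [i2]. *)
Lemma mixing_pair (R : realType) (T : finType) (X : {set {set T}})
    (j K : nat) (lambda : R) (U : 'I_j.+2 -> {set T}) (i1 i2 : 'I_j.+2) :
  simplicial_complex X -> pure X j.+1 -> connected_links X j.+1 ->
  regular X j.+1 K -> 0 < lambda < 1 ->
  (forall t, t \in faces X (j.+1%:Z - 2) ->
     forall a : R, passmx.leigenvalue (walk_op R (link X t)) a ->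
     a \in `[- (lambda / (1 + j%:R * lambda)), lambda / (1 + j%:R * lambda)]
     \/ a = 1) ->
  (forall i, U i \subset vertices X) ->
  (forall i k, i != k -> [disjoint U i & U k]) -> i1 != i2 ->
  `| #|transversal_faces X U|%:R
     - j.+1`!%:R * K%:R / #|vertices X|%:R ^+ j.+1 * \prod_i #|U i|%:R |
  <= mixing_const R j.+1 * j.+1`!%:R * lambda * K%:R * sqrt_cards R (U i1) (U i2).
Proof.
move=> X_complex X_pure X_links X_regular /andP[l_gt0 l_lt1] X_spectrum UX Udisj i12.
set F := faces X j.+1; set N : R := #|vertices X|%:R.
have F2 : uniform F j.+2 by apply: uniform_faces; lia.
have [s0 s0F _] := X_pure set0 (proj1 X_complex).
have [v0 v0s] : exists v, v \in s0 by apply/set0Pn; rewrite -card_gt0 F2.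
have v0X : v0 \in vertices X.
  by move: s0F => /setIdP[s0X _]; exact: vertices_sub v0s.
have K_gt0 : (0 < K)%N.
  rewrite -(X_regular v0)// card_gt0; apply/set0Pn; exists s0.
  by rewrite inE v0s andbT.
have N_gt0 : 0 < N by rewrite ltr0n card_gt0; apply/set0Pn; exists v0.
(* Incidences of vertices and facets, counted twice; this turns the number of ordered facets into
   [(j + 1)! K N]. *)
have KN : K%:R * N = j.+2%:R * #|F|%:R.
  by rewrite -(vsum1_faces R X_complex X_regular) -natrM (vsum1 R F2).
pose s := [seq i <- enum 'I_j.+2 | i \notin [:: i1; i2]].
have s_perm : perm_eq (s ++ [:: i1; i2]) (enum 'I_j.+2).
  apply: uniq_perm => [||i]; last 2 first.
  - exact: enum_uniq.
  - by rewrite mem_cat mem_filter mem_enum andbT /= orNb.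
  - rewrite cat_uniq filter_uniq ?enum_uniq//= !inE i12 andbT orbF negb_or.
    by rewrite !mem_filter !inE !eqxx ?orbT.
have size_s : size s = j.
  by have := perm_size s_perm; rewrite size_cat -cardE card_ord addn2 => -[].
pose a i v : R := (v \in U i)%:R.
have a01 i : unit_valued (a i).
  by move=> v; rewrite /a; case: (v \in U i); rewrite ?lexx ler01.
have mE i : mean F (a i) = #|U i|%:R / N.
  by rewrite -(mean_indicator R X_complex X_regular K_gt0 (UX i)).
have bounds := link_spectral_bounds X_complex X_pure X_links l_gt0 X_spectrum.
have l01 : 0 < lambda <= 1 by rewrite l_gt0 ltW.
have s_uniq : uniq (s ++ [:: i1; i2]) by rewrite (perm_uniq s_perm) enum_uniq.
have countE : ordered_count a F (s ++ [:: i1; i2]) = #|transversal_faces X U|%:R.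
  rewrite ordered_count_indicator//; last by rewrite size_cat size_s addn2.
  congr (#|pred_of_set _|%:R); apply/setP => x; rewrite !inE; congr (_ && _).
  rewrite (perm_all _ s_perm); apply/allP/forallP => H i; last by move=> _; exact: H.
  by apply: H; rewrite mem_enum.
rewrite -/F in bounds; clearbody F; rewrite -size_s in F2 bounds.
have := ordered_mixing a01 i1 i2 l01 F2 bounds erefl.
rewrite countE size_s !mE.
have -> : (j.+2`! * #|F|)%:R = j.+1`!%:R * K%:R * N :> R.
  by rewrite factS !natrM -[RHS]mulrA KN; ring.
have -> : \prod_(k <- s) mean F (a k) * (#|U i1|%:R / N * (#|U i2|%:R / N)) =
    \prod_i #|U i|%:R / N ^+ j.+2.
  have -> : \prod_i #|U i|%:R / N ^+ j.+2 = \prod_(k <- s ++ [:: i1; i2]) mean F (a k).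
    rewrite (perm_big _ s_perm) big_enum /= (eq_bigr _ (fun i _ => mE i)).
    by rewrite big_split /= prodr_const card_ord exprVn.
  by rewrite big_cat /= big_cons big_seq1 !mE.
have -> : Num.sqrt (#|U i1|%:R / N * (#|U i2|%:R / N)) = sqrt_cards R (U i1) (U i2) / N.
  rewrite /sqrt_cards mulrACA -[N^-1 * _]expr2 [LHS]sqrtrM ?mulr_ge0//.
  by rewrite sqrtr_sqr gtr0_norm ?invr_gt0.
have -> : j.+1`!%:R * K%:R * N * (\prod_i #|U i|%:R / N ^+ j.+2) =
    j.+1`!%:R * K%:R / N ^+ j.+1 * \prod_i #|U i|%:R.
  have : N ^+ j.+1 != 0 by rewrite expf_neq0 ?gt_eqF.
  rewrite (exprS N j.+1); move: (N ^+ j.+1) => M M_neq0.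
  by field; rewrite M_neq0 gt_eqF.
move=> /le_trans; apply.
have -> : mixing_rec R j * lambda * (j.+1`!%:R * K%:R * N) *
    (sqrt_cards R (U i1) (U i2) / N) =
    mixing_rec R j * (j.+1`!%:R * lambda * K%:R * sqrt_cards R (U i1) (U i2)).
  by field; rewrite gt_eqF.
rewrite -!(mulrA (mixing_const R j.+1)) ler_wpM2r ?mixing_rec_le//.
by rewrite !mulr_ge0 ?sqrtr_ge0// ltW.
Qed.

Theorem corollary1p3 (R : realType) (T : finType) (X : {set {set T}})
    (n K : nat) (lambda : R)
    (n_ge1 : (1 <= n)%N)
    (X_complex : simplicial_complex X)
    (X_pure : pure X n)
    (X_links : connected_links X n)
    (X_regular : regular X n K)
    (lambda_bounds : 0 < lambda < 1)
    (X_spectrum : forall t : {set T}, t \in faces X (n%:Z - 2) ->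
       forall a : R, passmx.leigenvalue (walk_op R (link X t)) a ->
       a \in `[- (lambda / (1 + (n%:R - 1) * lambda)),
               lambda / (1 + (n%:R - 1) * lambda)] \/ a = 1)
    (U : 'I_n.+1 -> {set T})
    (U_vertices : forall i, U i \subset vertices X)
    (U_disjoint : forall i j, i != j -> [disjoint U i & U j]) :
  `| #|transversal_faces X U|%:R
     - n`!%:R * K%:R / #|vertices X|%:R ^+ n * \prod_(i < n.+1) #|U i|%:R |
  <= mixing_const R n * n`!%:R * lambda * K%:R * min_sqrt_cards R U.
Proof.
case: n n_ge1 X_pure X_links X_regular X_spectrum U U_vertices U_disjoint
  => // j _ X_pure X_links X_regular X_spectrum U U_vertices U_disjoint.
rewrite (_ : j.+1%:R - 1 = j%:R) in X_spectrum; last by rewrite -natr1 addrK.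
have pair (i1 i2 : 'I_j.+2) : (i1 < i2)%N -> _ := fun lt =>
  mixing_pair X_complex X_pure X_links X_regular lambda_bounds X_spectrum
    U_vertices U_disjoint (negbT (ltn_eqF lt)).
(* A minimum of two numbers is one of them, so bounds for all pairs pass to the iterated minimum;
   its default value is the pair of first and last index. *)
apply: (big_ind (fun y => _ <= _ * y)) => [|x y Hx Hy|[i1 i2] /= lt].
- exact: pair.
- by rewrite minEle; case: ifP.
- exact: pair.
Qed.
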